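(* Let $n\ge1$ and let $\Gamma$ be a generalized dissection of $S(A_n)$ with $c_{P(1)}\in\Gamma$. (1) If $\mathrm{Tri}_\Gamma(S(A_n))$ contains no complete triangle, then $A^\Gamma$ is a hereditary tilted algebra of type $A_n$. (2) If $\mathrm{Tri}_\Gamma(S(A_n))$ contains at least one complete triangle, then $A^\Gamma$ is a non-hereditary tilted algebra of type $A_n$.
   Context: $\Bbbk$ is an algebraically closed field, $A_n=\Bbbk\mathcal{Q}$ is the path algebra of the quiver $\mathcal{Q}:1\to2\to\cdots\to n$; paths are composed from left to right ($\alpha\beta$ means first $\alpha$, then $\beta$) and modules are finitely generated right modules. An algebra is tilted of type $A_n$ if it is isomorphic to $\operatorname{End}_{A_n}(T)$ for a tilting $A_n$-module $T$. The surface $S(A_n)$. It is a closed disk with $n+3$ points on its boundary, in counterclockwise order $p,x_0,x_1,\dots,x_n,x_{n+1}$. The points $p,x_1,\dots,x_n$ are the marked points and $x_0,x_{n+1}$ are the two extra marked points. The disk carries the $n$ arcs $\Delta=\{px_1,\dots,px_n\}$, the arc $px_i$ corresponding to the vertex $i$ of $\mathcal{Q}$. Permissible curves in $S(A_n)$ (up to equivalence) are the curves joining two of these $n+3$ points, taken up to isotopy fixing endpoints and with minimal intersection; there is one for each pair of distinct points. A boundary segment is a segment of the boundary circle between two consecutive points among the $n+3$ points. A partial generalized dissection is a set of permissible curves, none homotopic to a boundary segment, any two of which do not meet in the interior of the disk; a generalized dissection is a maximal partial generalized dissection. The curve $c_{P(1)}$, corresponding to the indecomposable projective module $P(1)$,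 is the curve joining $x_0$ and $x_{n+1}$. Triangles. $\mathrm{Tri}_\Gamma(S(A_n))$ is the set of all triangles into which $\Gamma$ divides the disk (sides are curves of $\Gamma$ or boundary segments). A triangle is complete if all its three sides belong to $\Gamma$. The algebra $A^\Gamma$. For a generalized dissection $\Gamma$ containing $c_{P(1)}$, $A^\Gamma=\Bbbk Q/I$, where the vertices of $Q$ are the elements of $\Gamma$ (these all join points among $x_0,\dots,x_{n+1}$), and arrows and relations are given as follows. If $c_1,c_2\in\Gamma$ are two sides of a triangle of $\mathrm{Tri}_\Gamma(S(A_n))$ with common endpoint $q$, there is an arrow $c_1\to c_2$ if $c_1$ is obtained from $c_2$ by keeping $q$ fixed and moving the other endpoint clockwise along the boundary through successive points so that all curves obtained on the way, including $c_1$, are non-trivial, i.e. cross at least one arc of $\Delta$ in the interior. (Concretely, in a triangle with vertices $x_i,x_j,x_k$, $i<j<k$, the arrows are $x_ix_j\to x_ix_k$ and $x_ix_k\to x_jx_k$, whenever the curves involved lie in $\Gamma$.) The ideal $I$ is generated by all products $\alpha\beta$ of arrows such that $s(\alpha)$, $t(\alpha)=s(\beta)$ and $t(\beta)$ are the sides of one and the same triangle. *)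

(* Defs.v *)
From HB Require Import structures.
From mathcomp Require Import all_boot all_algebra.
From mathcomp Require Import generic_quotient ring_quotient.
From mathcomp Require Import finmap monalg.
From mathcomp Require Import boolp.

Set Implicit Arguments.
Unset Strict Implicit.
Unset Printing Implicit Defensive.

Import GRing.Theory.
Local Open Scope ring_scope.
Local Open Scope quotient_scope.

Section IdealQuotient.
Variables (k : comNzRingType) (A : algType k) (S : A -> Prop).

Inductive ideal_gen : A -> Prop :=
| Ideal_gen x : S x -> ideal_gen x
| Ideal_0 : ideal_gen 0
| Ideal_add x y : ideal_gen x -> ideal_gen y -> ideal_gen (x + y)
| Ideal_mull a x : ideal_gen x -> ideal_gen (a * x)
| Ideal_mulr a x : ideal_gen x -> ideal_gen (x * a).

Hypothesis S_proper : ~ ideal_gen 1.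

Definition ideal_pred : {pred A} := fun x => `[< ideal_gen x >].

Lemma ideal_predP x : reflect (ideal_gen x) (x \in ideal_pred).
Proof. exact: asboolP. Qed.

Lemma ideal_pred_zmod : zmod_closed ideal_pred.
Proof.
split=> [|x y /ideal_predP Ix /ideal_predP Iy].
  by apply/ideal_predP; apply: Ideal_0.
apply/ideal_predP; apply: Ideal_add Ix _.
by rewrite -mulN1r; apply: Ideal_mull.
Qed.

HB.instance Definition _ := GRing.isZmodClosed.Build A ideal_pred
  ideal_pred_zmod.

Definition quot_alg of ~ ideal_gen 1 : Type := Quotient.quot ideal_pred.
Local Notation Q := (quot_alg S_proper).

HB.instance Definition _ := GRing.Zmodule.on Q.
HB.instance Definition _ := EqQuotient.on Q.

Lemma quot_algP (x y : A) :
  reflect (ideal_gen (x - y)) (\pi_Q x == \pi_Q y).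
Proof. by rewrite -Quotient.idealrBE; apply: ideal_predP. Qed.

Definition quot_one : Q := \pi_Q (1 : A).
Definition quot_mul (x y : Q) : Q := \pi_Q (repr x * repr y).
Definition quot_scale (c : k) (x : Q) : Q := \pi_Q (c *: repr x).

Lemma repr_ideal (x : A) : ideal_gen (x - repr (\pi_Q x)).
Proof. by apply/quot_algP; rewrite reprK. Qed.

Lemma pi_quot_mul (x y : A) :
  quot_mul (\pi_Q x) (\pi_Q y) = \pi_Q (x * y).
Proof.
apply/esym/eqP/quot_algP; set x' := repr _; set y' := repr _.
have -> : x * y - x' * y' = x * (y - y') + (x - x') * y'.
  by rewrite mulrBr mulrBl addrA subrK.
apply: Ideal_add; first exact/Ideal_mull/repr_ideal.
exact/Ideal_mulr/repr_ideal.
Qed.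

Lemma pi_quot_scale c (x : A) :
  quot_scale c (\pi_Q x) = \pi_Q (c *: x).
Proof.
apply/esym/eqP/quot_algP; rewrite -scalerBr -[_ - _]mul1r scalerAl.
exact/Ideal_mull/repr_ideal.
Qed.

Lemma pi_quot_add (x y : A) : \pi_Q x + \pi_Q y = \pi_Q (x + y).
Proof. exact: (esym (Quotient.pi_add _ x y)). Qed.

Lemma quot_algW (P : Q -> Prop) : (forall x : A, P (\pi_Q x)) -> forall x, P x.
Proof. by move=> HP x; rewrite -[x]reprK; apply: HP. Qed.

Lemma quot_mulA : associative quot_mul.
Proof.
elim/quot_algW=> x; elim/quot_algW=> y; elim/quot_algW=> z.
by rewrite !pi_quot_mul mulrA.
Qed.
Lemma quot_mul1 : left_id quot_one quot_mul.
Proof. by elim/quot_algW=> x; rewrite pi_quot_mul mul1r. Qed.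
Lemma quot_mulr1 : right_id quot_one quot_mul.
Proof. by elim/quot_algW=> x; rewrite pi_quot_mul mulr1. Qed.
Lemma quot_mulDl : left_distributive quot_mul +%R.
Proof.
elim/quot_algW=> x; elim/quot_algW=> y; elim/quot_algW=> z.
by rewrite pi_quot_add !pi_quot_mul pi_quot_add mulrDl.
Qed.
Lemma quot_mulDr : right_distributive quot_mul +%R.
Proof.
elim/quot_algW=> x; elim/quot_algW=> y; elim/quot_algW=> z.
by rewrite pi_quot_add !pi_quot_mul pi_quot_add mulrDr.
Qed.

Lemma quot_one_neq0 : quot_one != 0.
Proof.
have <- : \pi_Q (0 : A) = 0.
  by apply: (addrI (\pi_Q (0 : A))); rewrite pi_quot_add !addr0.
apply/quot_algP; rewrite subr0.
exact: S_proper.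
Qed.

HB.instance Definition _ := GRing.Zmodule_isNzRing.Build Q
  quot_mulA quot_mul1 quot_mulr1 quot_mulDl quot_mulDr quot_one_neq0.

Lemma quot_scaleA a b (x : Q) :
  quot_scale a (quot_scale b x) = quot_scale (a * b) x.
Proof. by elim/quot_algW: x => x; rewrite !pi_quot_scale scalerA. Qed.
Lemma quot_scale1 : left_id 1 quot_scale.
Proof. by elim/quot_algW=> x; rewrite pi_quot_scale scale1r. Qed.
Lemma quot_scaleDr : right_distributive quot_scale +%R.
Proof.
move=> a; elim/quot_algW=> x; elim/quot_algW=> y.
by rewrite pi_quot_add !pi_quot_scale pi_quot_add scalerDr.
Qed.
Lemma quot_scaleDl (x : Q) :
  {morph quot_scale^~ x : a b / a + b}.
Proof.
elim/quot_algW: x => x a b.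
by rewrite !pi_quot_scale pi_quot_add scalerDl.
Qed.

HB.instance Definition _ := GRing.Zmodule_isLmodule.Build k Q
  quot_scaleA quot_scale1 quot_scaleDr quot_scaleDl.

Lemma quot_scaleAl c (x y : Q) : c *: (x * y) = (c *: x) * y.
Proof.
change (quot_scale c (quot_mul x y) = quot_mul (quot_scale c x) y).
elim/quot_algW: x => x; elim/quot_algW: y => y.
by rewrite !(pi_quot_mul, pi_quot_scale) scalerAl.
Qed.
Lemma quot_scaleAr c (x y : Q) : c *: (x * y) = x * (c *: y).
Proof.
change (quot_scale c (quot_mul x y) = quot_mul x (quot_scale c y)).
elim/quot_algW: x => x; elim/quot_algW: y => y.
by rewrite !(pi_quot_mul, pi_quot_scale) scalerAr.
Qed.

HB.instance Definition _ := GRing.Lmodule_isLalgebra.Build k Q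
  quot_scaleAl.
HB.instance Definition _ := GRing.Lalgebra_isAlgebra.Build k Q
  quot_scaleAr.

End IdealQuotient.

(* Quivers without multiple arrows: [e u v] says that there is a (then unique)
   arrow u -> v.  A path u -> v1 -> ... -> vm is the pair (u, [:: v1; ...; vm]);
   (u, [::]) is the trivial path at u. *)
Record qpath (V : finType) (e : rel V) := QPath {
  qpath_val : V * seq V;
  qpath_ok : path e qpath_val.1 qpath_val.2
}.

HB.instance Definition _ (V : finType) (e : rel V) :=
  [isSub for @qpath_val V e].

(* The two mixins are opaque: unfolding them makes conversion blow up in
   {malg k[qpath e]}. *)
Fact qpath_hasDecEq (V : finType) (e : rel V) : hasDecEq (qpath e).
Proof.
exists (fun p q => val p == val q) => p q.
by apply: (iffP eqP) => [/val_inj|->].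
Qed.
HB.instance Definition _ (V : finType) (e : rel V) := @qpath_hasDecEq V e.

Fact qpath_hasChoice (V : finType) (e : rel V) : hasChoice (qpath e).
Proof. exact: (PCanHasChoice (@valK _ _ (qpath e))). Qed.
HB.instance Definition _ (V : finType) (e : rel V) := @qpath_hasChoice V e.

Section PathAlgebra.
Variables (k : comNzRingType) (V : finType) (e : rel V) (v0 : V).
Local Notation P := (qpath e).

Definition qstart (p : P) : V := (val p).1.
Definition qend (p : P) : V := last (val p).1 (val p).2.
Definition qtriv (v : V) : P := @QPath V e (v, [::]) isT.

(* First p, then q; [insub] never fails here, see [pcat_spec]. *)
Definition pcat (p q : P) : option P :=
  if qend p == qstart q then @insub _ _ P ((val p).1, (val p).2 ++ (val q).2)
  else None.

(* The vertex v0 only witnesses that the quiver is not empty: the rings of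
   [algType] are nonzero. *)
Definition pathalg of V : Type := {malg k[P]}.
Local Notation KQ := (pathalg v0).
HB.instance Definition _ := GRing.Lmodule.on KQ.

Definition path_elt (p : P) : KQ := << p >>.

Definition pbmul (p q : P) : KQ := oapp path_elt 0 (pcat p q).

Definition pathalg_one : KQ := \sum_(v : V) path_elt (qtriv v).
Definition pathalg_mul (f g : KQ) : KQ :=
  \sum_(p <- msupp f) \sum_(q <- msupp g) (f@_p * g@_q) *: pbmul p q.

Lemma pcat_spec p q :
  if qend p == qstart q
  then exists2 r, pcat p q = Some r
                & val r = ((val p).1, (val p).2 ++ (val q).2)
  else pcat p q = None.
Proof.
rewrite /pcat; case: eqP => // Epq.
have pq : path e (val p).1 ((val p).2 ++ (val q).2).
  rewrite cat_path (valP p) /=; move: Epq; rewrite /qend => ->.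
  exact: (valP q).
by rewrite insubT; eexists; first by [].
Qed.

Lemma pcat_trivl v p : pcat (qtriv v) p = if v == qstart p then Some p else None.
Proof.
have := pcat_spec (qtriv v) p; rewrite /qend /=.
case: eqP => // -> [r -> Er]; congr Some.
apply: val_inj; apply: etrans Er _; rewrite /qstart /=; by case: (qpath_val p).
Qed.

Lemma pcat_trivr v p : pcat p (qtriv v) = if qend p == v then Some p else None.
Proof.
have := pcat_spec p (qtriv v); rewrite /qstart /=.
case: eqP => // _ [r -> Er]; congr Some.
apply: val_inj; apply: etrans Er _; rewrite cats0 /=; by case: (qpath_val p).
Qed.

Lemma pcatA p q r :
  obind (pcat p) (pcat q r) = obind (fun x => pcat x r) (pcat p q).
Proof.
have := pcat_spec q r; have := pcat_spec p q.
case: eqP => [Epq [pq -> Vpq]|Npq ->]; case: eqP => [Eqr [qr -> Vqr]|Nqr ->] //=.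
- have := pcat_spec pq r; have := pcat_spec p qr.
  have -> : qend pq = qend q by rewrite /qend Vpq /= last_cat -/(qend p) Epq.
  have -> : qstart qr = qstart q by rewrite /qstart Vqr.
  rewrite Epq Eqr !eqxx => -[x -> Vx] [y -> Vy]; congr Some.
  apply: val_inj; apply: etrans Vx _; apply: esym; apply: etrans Vy _.
  by rewrite Vpq Vqr /= catA.
- have := pcat_spec pq r.
  have -> : qend pq = qend q by rewrite /qend Vpq /= last_cat -/(qend p) Epq.
  by case: eqP.
- have := pcat_spec p qr.
  have -> : qstart qr = qstart q by rewrite /qstart Vqr.
  by case: eqP.
Qed.


Definition linear_fun (M : lmodType k) (F : KQ -> M) : Prop :=
  forall a f g, F (a *: f + g) = a *: F f + F g.

Lemma linear_fun_sum (M : lmodType k) (F : KQ -> M) : linear_fun F ->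
  forall f, F f = \sum_(p <- msupp f) f@_p *: F (path_elt p).
Proof.
move=> linF f.
have F0 : F 0 = 0.
  by apply: (addIr (F 0)); rewrite -[X in X + _]scale1r -linF scale1r !add0r.
have Fsum (s : seq P) :
    F (\sum_(p <- s) f@_p *: path_elt p) = \sum_(p <- s) f@_p *: F (path_elt p).
  by elim: s => [|p s IHs]; rewrite ?big_nil // !big_cons linF IHs.
rewrite -Fsum; congr F; rewrite [LHS]monalgE; apply: eq_bigr => p _.
by apply/malgP => q; rewrite mcoeffZ !mcoeffU mulrnAr mulr1.
Qed.

Lemma eq_linear_fun (M : lmodType k) (F G : KQ -> M) :
  linear_fun F -> linear_fun G ->
  (forall p, F (path_elt p) = G (path_elt p)) -> F =1 G.
Proof.
move=> linF linG FG f; rewrite !linear_fun_sum //.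
by apply: eq_bigr => p _; rewrite FG.
Qed.

Lemma linear_fun_lift (M : lmodType k) (F : P -> M) :
  linear_fun (fun f => \sum_(p <- msupp f) f@_p *: F p).
Proof.
move=> a f g; set D := (msupp (a *: f + g) `|` (msupp f `|` msupp g))%fset.
have wide h : (msupp h `<=` D)%fset ->
    \sum_(p <- msupp h) h@_p *: F p = \sum_(p <- D) h@_p *: F p.
  move=> hD; rewrite (big_fset_incl _ hD) //= => p _ /mcoeff_outdom ->.
  by rewrite scale0r.
rewrite !wide ?fsubsetUl //.
- rewrite scaler_sumr -big_split /=; apply: eq_bigr => p _.
  by rewrite mcoeffD mcoeffZ scalerDl scalerA.
- by rewrite /D fsetUA fsubsetUr.
- by rewrite /D fsetUCA fsubsetUl.
Qed.

Lemma pathalg_mulE f g : pathalg_mul f g =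
  \sum_(p <- msupp f) f@_p *: \sum_(q <- msupp g) g@_q *: pbmul p q.
Proof.
apply: eq_bigr => p _; rewrite scaler_sumr.
by apply: eq_bigr => q _; rewrite scalerA.
Qed.

Lemma linear_mull g : linear_fun (pathalg_mul^~ g).
Proof. by move=> a f h; rewrite !pathalg_mulE linear_fun_lift. Qed.

Lemma linear_mulr f : linear_fun (pathalg_mul f).
Proof.
move=> a g h; rewrite !pathalg_mulE scaler_sumr -big_split /=.
apply: eq_bigr => p _; rewrite linear_fun_lift scalerDr !scalerA.
by rewrite (mulrC a).
Qed.

Lemma pathalg_mulD : left_distributive pathalg_mul +%R.
Proof. by move=> f g h; have := linear_mull h 1 f g; rewrite !scale1r. Qed.

Lemma pathalg_mulDr : right_distributive pathalg_mul +%R.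
Proof. by move=> f g h; have := linear_mulr f 1 g h; rewrite !scale1r. Qed.

Lemma pathalg_mul0 f : pathalg_mul 0 f = 0.
Proof. by rewrite pathalg_mulE msupp0 big_seq_fset0. Qed.

Lemma pathalg_mulr0 f : pathalg_mul f 0 = 0.
Proof.
by apply: (addrI (pathalg_mul f 0)); rewrite -pathalg_mulDr !addr0.
Qed.

Lemma pathalg_scaleAl c f g :
  c *: pathalg_mul f g = pathalg_mul (c *: f) g.
Proof.
by rewrite -[c *: f]addr0 linear_mull pathalg_mul0 addr0.
Qed.

Lemma pathalg_scaleAr c f g :
  c *: pathalg_mul f g = pathalg_mul f (c *: g).
Proof.
by rewrite -[c *: g]addr0 linear_mulr pathalg_mulr0 addr0.
Qed.

Lemma pathalg_mulUU p q : pathalg_mul (path_elt p) (path_elt q) = pbmul p q.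
Proof.
rewrite pathalg_mulE /path_elt !msuppU oner_eq0 !big_seq_fset1 !mcoeffUU.
by rewrite !scale1r.
Qed.

Lemma pathalg_mulA : associative pathalg_mul.
Proof.
move=> f g h.
apply: (eq_linear_fun (F := fun f => pathalg_mul f (pathalg_mul g h))
  (G := fun f => pathalg_mul (pathalg_mul f g) h)) f => [||p].
- exact: linear_mull.
- by move=> a f f'; rewrite !linear_mull.
apply: (eq_linear_fun (F := fun g => pathalg_mul _ (pathalg_mul g h))
  (G := fun g => pathalg_mul (pathalg_mul _ g) h)) g => [||q].
- by move=> a g g'; rewrite linear_mull linear_mulr.
- by move=> a g g'; rewrite linear_mulr linear_mull.
apply: (eq_linear_fun (F := fun h => pathalg_mul _ (pathalg_mul _ h))
  (G := fun h => pathalg_mul (pathalg_mul _ _) h)) h => [||r].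
- by move=> a h h'; rewrite !linear_mulr.
- exact: linear_mulr.
rewrite !pathalg_mulUU /pbmul; have := pcatA p q r.
case: (pcat p q) => [pq|]; case: (pcat q r) => [qr|] //=;
  rewrite ?pathalg_mulUU ?pathalg_mul0 ?pathalg_mulr0 /pbmul.
- by move->.
- by move<-.
- by move->.
- by [].
Qed.

Lemma pathalg_mul_sumr (I : Type) (s : seq I) (F : I -> KQ) f :
  pathalg_mul f (\sum_(i <- s) F i) = \sum_(i <- s) pathalg_mul f (F i).
Proof.
exact: (big_morph _ (pathalg_mulDr f) (pathalg_mulr0 f)).
Qed.

Lemma pathalg_mul_suml (I : Type) (s : seq I) (F : I -> KQ) f :
  pathalg_mul (\sum_(i <- s) F i) f = \sum_(i <- s) pathalg_mul (F i) f.
Proof.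
exact: (big_morph (pathalg_mul^~ f) (fun x y => pathalg_mulD x y f)
  (pathalg_mul0 f)).
Qed.

Lemma pathalg_mul1 : left_id pathalg_one pathalg_mul.
Proof.
move=> f; apply: (eq_linear_fun (F := pathalg_mul pathalg_one) (G := id)) f.
- exact: linear_mulr.
- by [].
move=> p; rewrite pathalg_mul_suml (bigD1 (qstart p)) //= big1 => [|v vp].
  by rewrite addr0 pathalg_mulUU /pbmul pcat_trivl eqxx.
by rewrite pathalg_mulUU /pbmul pcat_trivl (negPf vp).
Qed.

Lemma pathalg_mulr1 : right_id pathalg_one pathalg_mul.
Proof.
move=> f; apply: (eq_linear_fun (F := pathalg_mul^~ pathalg_one) (G := id)) f.
- exact: linear_mull.
- by [].
move=> p; rewrite pathalg_mul_sumr (bigD1 (qend p)) //= big1 => [|v vp].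
  by rewrite addr0 pathalg_mulUU /pbmul pcat_trivr eqxx.
by rewrite pathalg_mulUU /pbmul pcat_trivr eq_sym (negPf vp).
Qed.

Lemma coeff_one v : pathalg_one@_(qtriv v) = 1.
Proof.
rewrite /pathalg_one raddf_sum (bigD1 v) //= mcoeffUU big1 ?addr0 // => w wv.
by rewrite mcoeffU; case: eqP => // -[wvE]; rewrite wvE eqxx in wv.
Qed.

Lemma pathalg_one_neq0 : pathalg_one != 0.
Proof.
apply/eqP => /(congr1 (mcoeff (qtriv v0))) /eqP.
by rewrite coeff_one mcoeff0 oner_eq0.
Qed.

HB.instance Definition _ := GRing.Zmodule_isNzRing.Build KQ
  pathalg_mulA pathalg_mul1 pathalg_mulr1 pathalg_mulD pathalg_mulDr
  pathalg_one_neq0.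
HB.instance Definition _ := GRing.Lmodule_isLalgebra.Build k KQ
  pathalg_scaleAl.
HB.instance Definition _ := GRing.Lalgebra_isAlgebra.Build k KQ
  pathalg_scaleAr.

(* The relations are the paths u -> v -> w of length two such that r u v w. *)
Definition relation_elts (r : V -> V -> V -> bool) (x : KQ) : Prop :=
  exists u v w (uvw : path e u [:: v; w]),
    r u v w /\ x = path_elt (@QPath V e (u, [:: v; w]) uvw).

Lemma coeff_triv_mul v (f g : KQ) :
  (f * g)@_(qtriv v) = f@_(qtriv v) * g@_(qtriv v).
Proof.
pose c (h : KQ) : k^o := h@_(qtriv v).
have linc : linear_fun c by move=> a h h'; rewrite /c mcoeffD mcoeffZ.
rewrite -!/(c _).
apply: (eq_linear_fun (F := fun f => c (f * g)) (G := fun f => c f * c g)) f.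
- by move=> a f f'; rewrite mulrDl -scalerAl linc.
- by move=> a f f'; rewrite linc mulrDl scalerAl.
move=> p.
apply: (eq_linear_fun (F := fun g => c (_ * g)) (G := fun g => _ * c g)) g.
- by move=> a g g'; rewrite mulrDr -scalerAr linc.
- by move=> a g g'; rewrite linc mulrDr scalerAr.
move=> q; have -> : path_elt p * path_elt q = pbmul p q by exact: pathalg_mulUU.
rewrite /c /pbmul /path_elt !mcoeffU; have := pcat_spec p q.
case: eqP => [Epq [r -> Er]|Npq ->] /=; last first.
  rewrite mcoeff0; case: eqP => [Ep|]; last by rewrite mul0r.
  case: eqP => [Eq|]; last by rewrite mulr0.
  by case: Npq; rewrite Ep Eq.
rewrite mcoeffU -!(inj_eq val_inj) Er; move: Epq; rewrite /qend /qstart /=.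
case: (qpath_val p) (qpath_val q) => [x s] [y t] /=.
rewrite -!pair_eqE /pair_eq /=; case: s => [|z s] /=.
  by move->; case: (y == v); case: t => //=; rewrite ?mul1r ?mulr0.
by rewrite !andbF mul0r.
Qed.

Lemma relation_ideal_proper r : ~ ideal_gen (relation_elts r) 1.
Proof.
move=> I1; suff : (1 : KQ)@_(qtriv v0) = 0.
  by move/eqP; rewrite coeff_one oner_eq0.
elim: I1 => [x [u [v [w [uvw [_ ->]]]]]||x y _ Hx _ Hy|a x _ Hx|a x _ Hx].
- by rewrite mcoeffU; case: eqP.
- by rewrite mcoeff0.
- by rewrite mcoeffD Hx Hy addr0.
- by rewrite coeff_triv_mul Hx mulr0.
- by rewrite coeff_triv_mul Hx mul0r.
Qed.

Definition bound_quiver_alg (r : V -> V -> V -> bool) : algType k :=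
  quot_alg (@relation_ideal_proper r).

End PathAlgebra.

(* The path algebra of 1 -> 2 -> ... -> n, with vertices numbered from 0. *)
Definition linear_quiver (n : nat) : rel 'I_n := fun i j => j == i.+1 :> nat.

Definition linear_alg (k : comNzRingType) (n : nat) (n_gt0 : (0 < n)%N) :
    algType k :=
  pathalg k (@linear_quiver n) (Ordinal n_gt0).

(* These notions will be used with R := A^c, the converse ring of an algebra A:
   left modules over A^c are right modules over A. *)
Section Modules.
Variable R : pzRingType.

Definition surj (M N : Type) (f : M -> N) : Prop := forall y, exists x, f x = y.

Definition projective (P : lmodType R) : Prop :=
  forall (M N : lmodType R) (g : {linear M -> N}) (f : {linear P -> N}),
    surj g -> exists h : {linear P -> M}, g \o h =1 f.

Definition short_exact (L M N : lmodType R)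
    (f : {linear L -> M}) (g : {linear M -> N}) : Prop :=
  [/\ injective f, surj g & forall y, g y = 0 <-> exists x, f x = y].

Definition fin_gen (M : lmodType R) : Prop :=
  exists (m : nat) (g : {linear {ffun 'I_m -> R^o} -> M}), surj g.

Definition pdim_le1 (T : lmodType R) : Prop :=
  exists (P1 P0 : lmodType R) (f : {linear P1 -> P0}) (g : {linear P0 -> T}),
    [/\ projective P1, projective P0 & short_exact f g].

(* Vanishing of Yoneda's Ext^1(N, L): every extension splits. *)
Definition ext1_vanishes (N L : lmodType R) : Prop :=
  forall (E : lmodType R) (f : {linear L -> E}) (g : {linear E -> N}),
    short_exact f g -> exists s : {linear N -> E}, cancel s g.

(* X is a direct summand of some T^m. *)
Definition in_add (T X : lmodType R) : Prop :=
  exists (m : nat) (i : {linear X -> {ffun 'I_m -> T}})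
         (r : {linear {ffun 'I_m -> T} -> X}), cancel i r.

Definition tilting_module (T : lmodType R) : Prop :=
  [/\ fin_gen T, pdim_le1 T, ext1_vanishes T T &
      exists (T' T'' : lmodType R)
             (f : {linear R^o -> T'}) (g : {linear T' -> T''}),
        [/\ in_add T T', in_add T T'' & short_exact f g]].

(* Every left ideal of R (the image of an injective i) is projective. *)
Definition left_hereditary : Prop :=
  forall (J : lmodType R) (i : {linear J -> R^o}), injective i -> projective J.

End Modules.

Definition hereditary (k : comNzRingType) (A : algType k) : Prop :=
  left_hereditary A^c.

(* Phi : B -> End_A(T) is an isomorphism of k-algebras, where T is a right
   A-module, the product of End_A(T) is the composition of maps and k acts on
   T through A. *)
Definition is_end_iso (k : comNzRingType) (A B : algType k) (T : lmodType A^c)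
    (Phi : B -> {linear T -> T}) : Prop :=
  [/\ forall x y, Phi (x + y) =1 Phi x \+ Phi y,
      forall c x t, Phi (c *: x) t = (c%:A : A^c) *: Phi x t,
      Phi 1 =1 id,
      forall x y, Phi (x * y) =1 Phi x \o Phi y &
      forall f : {linear T -> T},
        exists2 x, Phi x =1 f & forall y, Phi y =1 f -> y = x].

Definition tilted_of (k : comNzRingType) (A B : algType k) : Prop :=
  exists T : lmodType A^c,
    tilting_module T /\ exists Phi : B -> {linear T -> T}, is_end_iso Phi.

(* The n + 3 points p, x_0, ..., x_(n+1) on the circle are numbered
   0, 1, ..., n + 2 counterclockwise: [ordS] and [ord_pred] (cyclic successor
   and predecessor) are one step counterclockwise and clockwise.  A curve, up to
   equivalence, is a set of two points. *)
Section Disk.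
Variable n : nat.

Definition point : finType := 'I_n.+3.
Definition curve : finType := {set point}.

Definition pt_p : point := ord0.
Definition pt_x (i : 'I_n.+2) : point := lift ord0 i.

Definition is_curve (c : curve) : bool := #|c| == 2.

Definition interleaved (c d : curve) : bool :=
  [exists a : 'I_n.+3, exists a' : 'I_n.+3,
   exists b : 'I_n.+3, exists b' : 'I_n.+3,
     [&& a < a', a' < b, b < b', c == [set a; b] & d == [set a'; b']]]%N.

Definition cross (c d : curve) : bool := interleaved c d || interleaved d c.

Definition boundary_segment (c : curve) : bool :=
  [exists a : 'I_n.+3, c == [set a; ordS a]].

Definition partial_dissection (Gamma : {set curve}) : bool :=
  [forall c in Gamma, is_curve c && ~~ boundary_segment c] &&
  [forall c in Gamma, forall d in Gamma, ~~ cross c d].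

Definition generalized_dissection (Gamma : {set curve}) : bool :=
  maxset partial_dissection Gamma.

Definition c_P1 : curve := [set pt_x ord0; pt_x ord_max].

Definition Delta : {set curve} :=
  [set [set pt_p; pt_x i] | i : 'I_n.+2 & (0 < i < n.+1)%N].

Definition nontrivial (c : curve) : bool := [exists d in Delta, cross c d].

(* A triangle is given by its three vertices.  As no curve of a dissection
   crosses a side, such a triangle is a region of the dissected disk. *)
Definition sides (t : {set point}) : {set curve} :=
  [set c : curve | is_curve c & c \subset t].

Definition Tri (Gamma : {set curve}) : {set {set point}} :=
  [set t : {set point} | (#|t| == 3) &&
    [forall c in sides t, (c \in Gamma) || boundary_segment c]].

Definition complete (Gamma : {set curve}) (t : {set point}) : bool :=
  sides t \subset Gamma.

(* c1 is obtained from c2 = qb by moving b clockwise in m steps, all curves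
   obtained on the way being non-trivial.  The moving end cannot pass through q,
   since [set q; q] is not nontrivial. *)
Definition clockwise_move (q : point) (c2 c1 : curve) : bool :=
  [exists b : 'I_n.+3, exists m : 'I_n.+3,
     [&& c2 == [set q; b], c1 == [set q; iter m (@ord_pred _) b] &
         [forall l : 'I_n.+3, (0 < l <= m)%N ==>
            nontrivial [set q; iter l (@ord_pred _) b]]]].

Definition arrow (Gamma : {set curve}) (c1 c2 : curve) : bool :=
  (c1 != c2) &&
  [exists t in Tri Gamma, [&& c1 \in sides t, c2 \in sides t &
     [exists q in c1 :&: c2, clockwise_move q c2 c1]]].

Definition same_triangle (Gamma : {set curve}) (c1 c2 c3 : curve) : bool :=
  [exists t in Tri Gamma, sides t == [set c1; c2; c3]].

Definition vertex (Gamma : {set curve}) : finType := {c : curve | c \in Gamma}.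

Definition A_Gamma (k : comNzRingType) (Gamma : {set curve})
    (P1_in : c_P1 \in Gamma) : algType k :=
  bound_quiver_alg k
    (fun c1 c2 : vertex Gamma => arrow Gamma (val c1) (val c2))
    (exist _ c_P1 P1_in)
    (fun c1 c2 c3 => same_triangle Gamma (val c1) (val c2) (val c3)).

End Disk.

(* Main.v *)
From HB Require Import structures.
Require Import Defs.
From mathcomp Require Import all_boot all_algebra.
From mathcomp Require Import generic_quotient ring_quotient finmap monalg boolp.
From mathcomp Require Import zify.

(** Why the theorem holds.

    The chord x_0 x_(n+1) cuts p off, so a generalized dissection containing it
    is a triangulation of the polygon x_0 ... x_(n+1): a maximal set of pairwise
    non-crossing arcs (i, k), i + 2 <= k ([arc_system], [dissection_arcs]).  In a
    triangle i < j < k the arrows are (i, j) -> (i, k) and (i, k) -> (j, k), and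
    their product is a relation ([arrow_arcs], [same_triangle_intro]).  Along a path both end points of
    the arc can only increase.  A path that moves both of them somewhere turns
    from moving the right end to moving the left end, and this happens inside
    one triangle, so the path is zero; a path that moves only one of them passes
    through all the arcs in between and is determined by its ends.  Hence the
    algebra of the dissection has a basis indexed by the pairs of arcs that share
    an end point suitably ([arc_rel]), and its product is the matrix product with
    the entries outside [arc_rel] thrown away.  The type [coordinates] records
    such a description, and [arc_coordinates] establishes it; from there on the
    algebra is only used through its coordinates.

    Tilting.  Let M(i, k) be the interval module supported on the vertices
    strictly between i and k, and T the sum of the M(v) over the arcs v.  Maps
    between sums of interval modules are matrices of scalars ([matrix_mapP]), so
    End(T) has the very same coordinates ([end_map_iso]).  The module T is
    tilting ([arc_module_tilting]):
    - 0 -> P(k) -> P(i+1) -> M(i, k) -> 0 is a projective resolution;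
    - as arcs do not cross, a matrix that defines a map from the P(k) to T also
      defines one from the P(i+1) to T, so that Ext^1(T, T) = 0;
    - for a vertex a, the arcs w around a form a chain, and
      0 -> P(a) -> sum of M(w) -> sum of N(a, w) -> 0 is exact, where N(a, w)
      compares w with the next smaller arc around a and is itself M of an arc,
      or zero.

    Heredity.  Without complete triangle no two consecutive arrows form a
    relation, so [arc_rel] is transitive, and its intervals are chains.  Then
    every right ideal is a direct sum of cyclic modules isomorphic to indecomposable
    projectives, which are split off one at a time; this gives a dual basis
    ([linear_dual_basis]).  A complete triangle gives arrows a and b with
    a * b = 0; if the right ideal a B were projective, there would be c with
    a * c = a and c * b = 0, which the coordinates rule out
    ([zero_product_not_hereditary]). *)

Set Implicit Arguments.
Unset Strict Implicit.
Unset Printing Implicit Defensive.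

Import GRing.Theory.
Local Open Scope ring_scope.

(** * Linear maps, submodules and dual bases *)

Section LinearOf.
Variables (R : pzRingType) (U V : lmodType R) (f : U -> V).
(** A named function, so that a linearity proof can be turned into a structure. *)
Definition linear_of of linear f := f.
Hypothesis lin_f : linear f.
HB.instance Definition _ := GRing.isLinear.Build R U V *:%R (linear_of lin_f) lin_f.
Definition linear_map : {linear U -> V} := linear_of lin_f.
End LinearOf.

Lemma linear_mapE (R : pzRingType) (U V : lmodType R) (f : U -> V)
  (lin_f : linear f) : linear_map lin_f =1 f.
Proof. by []. Qed.

(** The easy half of the dual basis lemma: if every f(x_p) is lifted to some m_p,
    then y |-> \sum_p pi_p(y) m_p lifts f. *)
Lemma projective_dual_basis (R : pzRingType) (P : lmodType R)
  (s : seq (P * {linear P -> R^o})) :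
  (forall y, y = \sum_(p <- s) (p.2 y : R) *: p.1) -> projective P.
Proof.
move=> yE M N g f surj_g.
pose m (x : P) := projT1 (cid (surj_g (f x))).
have gm x : g (m x) = f x by rewrite /m; case: cid.
pose h (y : P) := \sum_(p <- s) (p.2 y : R) *: m p.1.
have lin_h : linear h.
  move=> a x y; rewrite /h scaler_sumr -big_split; apply: eq_bigr => p _.
  by rewrite linearP scalerDl scalerA.
exists (linear_map lin_h) => y; rewrite /= linear_mapE.
rewrite {2}[y]yE !linear_sum; apply: eq_bigr => p _.
by rewrite !linearZ gm.
Qed.

Section Submodule.
Variables (R : pzRingType) (M : lmodType R) (S : M -> Prop).
(** The closure proofs are arguments, so that the submodule structure can be
    inferred from the predicate. *)
Definition sub_pred of (forall a x y, S x -> S y -> S (a *: x + y)) & S 0 :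
  {pred M} := fun x => `[< S x >].
Hypothesis SP : forall a x y, S x -> S y -> S (a *: x + y).
Hypothesis S0 : S 0.
Local Notation sp := (sub_pred SP S0).
Fact sub_pred_closed : submod_closed sp.
Proof.
split; first by apply/asboolP.
by move=> a x y /asboolP Sx /asboolP Sy; apply/asboolP; apply: SP.
Qed.
HB.instance Definition _ := GRing.isSubmodClosed.Build R M sp sub_pred_closed.
Definition submodule := {x : M | x \in sp}.
HB.instance Definition _ := [isSub for (@sval _ _ : submodule -> M)].
HB.instance Definition _ := [Choice of submodule by <:].
HB.instance Definition _ := [SubChoice_isSubLmodule of submodule by <:].
End Submodule.

(** * Algebras with coordinates *)

(** The algebra A has a basis indexed by the pairs in r, and elements multiply as
    matrices whose entries outside r are discarded.  When r is a partial order
    this is its incidence algebra; r need not be transitive, and then some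
    products of basis elements vanish. *)
Record coordinates (k : comNzRingType) (A : algType k) (V : finType)
    (r : rel V) := Coordinates {
  coord :> A -> V -> V -> k;
  coordP : forall a f g u v,
    coord (a *: f + g) u v = a * coord f u v + coord g u v;
  coord1 : forall u v, coord 1 u v = (u == v)%:R;
  coordM : forall f g u w, r u w ->
    coord (f * g) u w = \sum_v coord f u v * coord g v w;
  coord_out : forall f u v, ~~ r u v -> coord f u v = 0;
  coord_eq0 : forall f, (forall u v, r u v -> coord f u v = 0) -> f = 0;
  coord_surj : forall C : V -> V -> k,
    exists f, forall u v, r u v -> coord f u v = C u v
}.

Section CoordTheory.
Variables (k : comNzRingType) (A : algType k) (V : finType) (r : rel V).
Variable cA : coordinates A r.

Lemma coord0 u v : cA 0 u v = 0.
Proof. by have := coordP cA (-1) 0 0 u v; rewrite scaler0 addr0 mulN1r addNr. Qed.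

Lemma coordZ c a u v : cA (c *: a) u v = c * cA a u v.
Proof. by rewrite -[_ *: _]addr0 coordP coord0 addr0. Qed.

Lemma coordD a b u v : cA (a + b) u v = cA a u v + cA b u v.
Proof. by rewrite -[a]scale1r coordP mul1r scale1r. Qed.

Lemma coordB a b u v : cA (a - b) u v = cA a u v - cA b u v.
Proof. by rewrite coordD -scaleN1r coordZ mulN1r. Qed.

Lemma coord_ext a b : (forall u v, r u v -> cA a u v = cA b u v) -> a = b.
Proof.
move=> ab; apply/eqP; rewrite -subr_eq0; apply/eqP.
by apply: (coord_eq0 (c := cA)) => u v ruv; rewrite coordB ab // subrr.
Qed.

Definition elt_of (C : V -> V -> k) : A := projT1 (cid (coord_surj cA C)).

Lemma coord_elt C u v : cA (elt_of C) u v = if r u v then C u v else 0.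
Proof.
rewrite /elt_of; case: cid => a aE /=.
by case: ifPn => [/aE|/coord_out].
Qed.

Lemma coord_scalar c u v : cA c%:A u v = c * (u == v)%:R.
Proof. by rewrite coordZ coord1. Qed.

Lemma coord_neq0 a u v : cA a u v != 0 -> r u v.
Proof. by apply: contraR => /(coord_out cA) ->. Qed.

Lemma coordinates_refl u : r u u.
Proof. by apply: (@coord_neq0 1); rewrite coord1 eqxx oner_eq0. Qed.

End CoordTheory.

(** * Coordinates of bound quiver algebras *)

(** The relation r selects the pairs of vertices joined by a path that will not
    be killed by the relations.  By [r_factor] a surviving path has surviving
    pieces, which is what makes the coordinates multiplicative. *)
Section PathCoordinates.
Variables (k : comNzRingType) (V : finType) (e : rel V) (v0 : V) (r : rel V).
Local Notation P := (qpath e).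
Local Notation KQ := (pathalg k e v0).
Implicit Types (p q : P) (f g : KQ).

Hypothesis r_refl : reflexive r.
Hypothesis r_factor : forall p q, qend p = qstart q -> r (qstart p) (qend q) ->
  r (qstart p) (qend p) /\ r (qstart q) (qend q).
Hypothesis r_path : forall u v, r u v -> exists2 p : P, qstart p = u & qend p = v.
Hypothesis r_uniq : forall p q, r (qstart p) (qend p) ->
  qstart p = qstart q -> qend p = qend q -> p = q.

Definition path_coord p (u w : V) : k :=
  ([&& r u w, qstart p == u & qend p == w])%:R.

(** Summing over all paths from u to w rather than picking one makes linearity
    and multiplicativity independent of the uniqueness of paths. *)
Definition pathalg_coord f (u w : V) : k^o :=
  \sum_(p <- msupp f) f@_p *: (path_coord p u w : k^o).

Lemma pathalg_coord_linear u w : linear_fun (fun f => pathalg_coord f u w).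
Proof. exact: (linear_fun_lift (M := k^o)). Qed.

Lemma pathalg_coordP a f g u w : pathalg_coord (a *: f + g) u w =
  a * pathalg_coord f u w + pathalg_coord g u w.
Proof. by rewrite pathalg_coord_linear. Qed.

Lemma pathalg_coord0 u w : pathalg_coord 0 u w = 0.
Proof. by rewrite /pathalg_coord msupp0 big_seq_fset0. Qed.

Lemma pathalg_coordD f g u w : pathalg_coord (f + g) u w =
  pathalg_coord f u w + pathalg_coord g u w.
Proof. by rewrite -[f]scale1r pathalg_coordP mul1r scale1r. Qed.

Lemma pathalg_coordB f g u w : pathalg_coord (f - g) u w =
  pathalg_coord f u w - pathalg_coord g u w.
Proof.
by rewrite addrC -[- g]scaleN1r pathalg_coordP mulN1r addrC.
Qed.

Lemma pathalg_coord_sum (I : Type) (s : seq I) (F : I -> KQ) u w :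
  pathalg_coord (\sum_(i <- s) F i) u w = \sum_(i <- s) pathalg_coord (F i) u w.
Proof.
elim: s => [|i s IHs]; first by rewrite !big_nil pathalg_coord0.
by rewrite !big_cons pathalg_coordD IHs.
Qed.

Lemma pathalg_coordE p u w :
  pathalg_coord (path_elt k v0 p) u w = path_coord p u w.
Proof.
rewrite /pathalg_coord /path_elt msuppU oner_eq0 big_seq_fset1 mcoeffUU.
by rewrite scale1r.
Qed.

Lemma pathalg_coord1 u w : pathalg_coord 1 u w = (u == w)%:R.
Proof.
rewrite (pathalg_coord_sum _ (fun v => path_elt k v0 (qtriv e v))) /=.
rewrite (bigD1 u) //= big1 ?addr0 => [|v vu]; rewrite pathalg_coordE /path_coord.
  rewrite /qstart /qend /= eqxx /=; case: (u =P w) => [<-|]; rewrite ?r_refl //.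
  by rewrite andbF.
by rewrite /qstart /= (negPf vu) /= andbF.
Qed.

Lemma pathalg_coord_out f u w : ~~ r u w -> pathalg_coord f u w = 0.
Proof.
move=> ruw; rewrite /pathalg_coord big1 // => p _.
by rewrite /path_coord (negPf ruw) scaler0.
Qed.

Lemma pathalg_coordM f g u w : r u w ->
  pathalg_coord (f * g) u w = \sum_v pathalg_coord f u v * pathalg_coord g v w.
Proof.
move=> ruw.
apply: (eq_linear_fun (M := k^o) (F := fun f => pathalg_coord (f * g) u w)
  (G := fun f => \sum_v pathalg_coord f u v * pathalg_coord g v w)) f.
- by move=> a f f'; rewrite mulrDl -scalerAl pathalg_coord_linear.
- move=> a f f'; rewrite scaler_sumr -big_split; apply: eq_bigr => v _ /=.
  by rewrite pathalg_coordP mulrDl -mulrA.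
move=> p.
apply: (eq_linear_fun (M := k^o) (F := fun g => pathalg_coord (_ * g) u w)
  (G := fun g => \sum_v pathalg_coord _ u v * pathalg_coord g v w)) g.
- by move=> a g g'; rewrite mulrDr -scalerAr pathalg_coord_linear.
- move=> a g g'; rewrite scaler_sumr -big_split; apply: eq_bigr => v _ /=.
  by rewrite pathalg_coordP mulrDr; congr (_ + _); rewrite mulrCA.
move=> q.
have -> : path_elt k v0 p * path_elt k v0 q = pbmul k v0 p q.
  exact: pathalg_mulUU.
under eq_bigr do rewrite !pathalg_coordE.
rewrite /pbmul; have := pcat_spec p q; have [Epq|Npq] := eqVneq (qend p) (qstart q).
  case=> s -> Es /=; rewrite pathalg_coordE (bigD1 (qend p)) //= big1 => [|v vp].
    have Ess : qstart s = qstart p by rewrite /qstart Es.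
    have Ese : qend s = qend q by rewrite /qend Es /= last_cat -/(qend p) Epq.
    rewrite addr0 /path_coord Ess Ese ruw Epq !eqxx andbT /= -natrM mulnb.
    have [Ep|//] := eqVneq (qstart p) u; last by rewrite andbF.
    have [Eq|//] := eqVneq (qend q) w; last by rewrite !andbF.
    have := @r_factor p q Epq; rewrite Ep Eq ruw Epq => -[] // -> ->.
    by [].
  by rewrite /path_coord [qend p == v]eq_sym (negPf vp) !andbF mul0r.
move=> -> /=; rewrite pathalg_coord0 big1 // => v _.
rewrite /path_coord -natrM mulnb; case: (qend p =P v) => [<-|]; last first.
  by rewrite !andbF.
by rewrite [qstart q == _]eq_sym (negPf Npq) !andbF.
Qed.

Lemma pathalg_coord_surj (C : V -> V -> k) :
  exists f, forall u v, r u v -> pathalg_coord f u v = C u v.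
Proof.
pose pth u v := if pselect (r u v) is left ruv
  then path_elt k v0 (s2val (cid2 (r_path ruv))) else 0.
exists (\sum_u \sum_v C u v *: pth u v) => u v ruv.
have pthE u' v' : r u' v' -> pathalg_coord (pth u' v') u v = ((u' == u) && (v' == v))%:R.
  move=> ruv'; rewrite /pth; case: pselect => // ruv2.
  case: cid2 => p /= Ep Eq; rewrite pathalg_coordE /path_coord Ep Eq.
  by rewrite ruv.
have CE u' v' : pathalg_coord (C u' v' *: pth u' v') u v =
    C u' v' * ((u' == u) && (v' == v))%:R.
  rewrite -[_ *: _]addr0 pathalg_coordP pathalg_coord0 addr0.
  have [/pthE -> //|nr] := boolP (r u' v').
  rewrite /pth; case: pselect => [ruv'|_]; first by rewrite ruv' in nr.
  rewrite pathalg_coord0 mulr0; case: eqP => [Eu|]; case: eqP => [Ev|]; rewrite ?mulr0 //.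
  by rewrite Eu Ev ruv in nr.
rewrite pathalg_coord_sum (bigD1 u) //= [X in _ + X]big1 ?addr0 => [|u' u'u].
  rewrite pathalg_coord_sum (bigD1 v) //= CE !eqxx mulr1 big1 ?addr0 // => v' v'v.
  by rewrite CE (negPf v'v) andbF mulr0.
by rewrite pathalg_coord_sum big1 // => v' _; rewrite CE (negPf u'u) mulr0.
Qed.

(** Modulo the ideal only the paths whose ends are related by r remain; there is
    one for each pair in r, so its coefficient is a coordinate. *)
Lemma pathalg_coord_eq0 (S : KQ -> Prop) f :
  (forall p, ~~ r (qstart p) (qend p) -> ideal_gen S (path_elt k v0 p)) ->
  (forall u v, r u v -> pathalg_coord f u v = 0) -> ideal_gen S f.
Proof.
move=> Snr f0.
have scaleI a x : ideal_gen S x -> ideal_gen S (a *: x).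
  by rewrite -[x]mul1r scalerAl => Sx; apply: Ideal_mull; rewrite mul1r in Sx.
have fE : f = \sum_(p <- msupp f) f@_p *: path_elt k v0 p.
  by rewrite -(linear_fun_sum (M := pathalg k e v0) (F := id)).
have : forall p, p \in msupp f -> ideal_gen S (f@_p *: path_elt k v0 p).
  move=> p pf; have [rp|/Snr] := boolP (r (qstart p) (qend p)); last exact: scaleI.
  have := f0 _ _ rp; rewrite /pathalg_coord (big_fsetD1 p) //= big1_fset.
    rewrite addr0 /path_coord rp !eqxx [_ *: _]mulr1 => ->.
    by rewrite scale0r; apply: Ideal_0.
  move=> q; rewrite in_fsetD1 /path_coord => /andP[qp _] _.
  case: and3P => [[_ /eqP Es /eqP Ee]|]; last by rewrite scaler0.
  by rewrite (@r_uniq p q) ?eqxx in qp.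
move=> H; have: ideal_gen S (\sum_(p <- msupp f) f@_p *: path_elt k v0 p).
  by rewrite big_seq; elim/big_ind: _ => //; [apply: Ideal_0 | apply: Ideal_add].
by rewrite -fE.
Qed.

Lemma pathalg_coordinates :
  (forall p, r (qstart p) (qend p)) ->
  inhabited (coordinates (pathalg k e v0) r).
Proof.
move=> r_all; constructor.
apply: (@Coordinates k (pathalg k e v0) V r pathalg_coord).
- exact: pathalg_coordP.
- exact: pathalg_coord1.
- exact: pathalg_coordM.
- exact: pathalg_coord_out.
- move=> f f0; have : ideal_gen (fun _ => False) f.
    by apply: pathalg_coord_eq0 => // p; rewrite r_all.
  by elim=> // [x y _ -> _ ->|a x _ ->|a x _ ->]; rewrite ?addr0 ?mulr0 ?mul0r.
- exact: pathalg_coord_surj.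
Qed.

Variable rl : V -> V -> V -> bool.
Hypothesis rl_r : forall u v w, rl u v w -> e u v -> e v w -> ~~ r u w.
Hypothesis r_rl : forall p, ~~ r (qstart p) (qend p) ->
  ideal_gen (relation_elts rl) (path_elt k v0 p).

Lemma pathalg_coord_ideal f :
  ideal_gen (relation_elts rl) f -> forall u v, pathalg_coord f u v = 0.
Proof.
elim=> [x [u' [v' [w' [ok [ruvw ->]]]]]||x y _ Ix _ Iy|a x _ Ix|a x _ Ix] u v.
- rewrite pathalg_coordE /path_coord /qstart /qend /=.
  move: (ok) => /= /and3P[/(rl_r ruvw) H /H nr _].
  case: and3P => // -[ruv /eqP Eu /eqP Ev].
  by rewrite Eu Ev ruv in nr.
- exact: pathalg_coord0.
- by rewrite pathalg_coordD Ix Iy addr0.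
- have [ruv|/pathalg_coord_out->//] := boolP (r u v).
  by rewrite pathalg_coordM // big1 // => x' _; rewrite Ix mulr0.
- have [ruv|/pathalg_coord_out->//] := boolP (r u v).
  by rewrite pathalg_coordM // big1 // => x' _; rewrite Ix mul0r.
Qed.

Local Notation B := (bound_quiver_alg k e v0 rl).
Local Open Scope quotient_scope.

Definition bound_coord (x : B) u v : k := pathalg_coord (repr x) u v.

Lemma bound_coordE f u v : bound_coord (\pi_B f) u v = pathalg_coord f u v.
Proof.
apply/eqP; rewrite -subr_eq0 -pathalg_coordB; apply/eqP.
apply: pathalg_coord_ideal.
have := repr_ideal (@relation_ideal_proper _ _ _ v0 rl) f.
rewrite -opprB -mulN1r => /(Ideal_mull (-1)); by rewrite !mulN1r !opprK.
Qed.

Lemma bound_coordinates : inhabited (coordinates B r).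
Proof.
constructor; apply: (@Coordinates k B V r bound_coord).
- move=> a; elim/quot_algW=> f; elim/quot_algW=> g u v.
  by rewrite [a *: _]pi_quot_scale pi_quot_add !bound_coordE pathalg_coordP.
- by move=> u v; rewrite bound_coordE pathalg_coord1.
- elim/quot_algW=> f; elim/quot_algW=> g u w ruw.
  rewrite [_ * _]pi_quot_mul bound_coordE pathalg_coordM //.
  by apply: eq_bigr => v _; rewrite !bound_coordE.
- by elim/quot_algW=> f u v nr; rewrite bound_coordE pathalg_coord_out.
- elim/quot_algW=> f f0; rewrite -[RHS](_ : \pi_B 0 = 0).
    apply/eqP/quot_algP; rewrite subr0; apply: pathalg_coord_eq0 => // u v ruv.
    by rewrite -bound_coordE f0.
  by apply: (addrI (\pi_B (0 : KQ))); rewrite pi_quot_add !addr0.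
- move=> C; have [f fC] := pathalg_coord_surj C; exists (\pi_B f) => u v ruv.
  by rewrite bound_coordE fC.
Qed.

(** A path containing a relation is the product of three paths, the middle one
    being a generator of the ideal. *)
Lemma ideal_path x s1 y z s2 (ok : path e x (s1 ++ y :: z :: s2)) :
  rl (last x s1) y z ->
  ideal_gen (relation_elts rl) (path_elt k v0 (@QPath V e (x, s1 ++ y :: z :: s2) ok)).
Proof.
move=> rlxyz; have := ok; rewrite cat_path /= => /and4P[ok1 exy eyz ok2].
have ok3 : path e (last x s1) [:: y; z] by rewrite /= exy eyz.
pose p1 := @QPath V e (x, s1) ok1; pose p2 := @QPath V e (last x s1, [:: y; z]) ok3.
pose p3 := @QPath V e (z, s2) ok2.
have mulE (p q s : P) : qend p = qstart q ->
    val s = ((val p).1, (val p).2 ++ (val q).2) ->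
    path_elt k v0 s = path_elt k v0 p * path_elt k v0 q.
  move=> Epq Es; have -> : path_elt k v0 p * path_elt k v0 q = pbmul k v0 p q.
    exact: pathalg_mulUU.
  rewrite /pbmul; have := pcat_spec p q; rewrite Epq eqxx => -[s' -> Es'] /=.
  by congr path_elt; apply: val_inj; rewrite Es Es'.
have ok12 : path e x (s1 ++ [:: y; z]) by rewrite cat_path ok1.
rewrite (mulE (@QPath V e (x, s1 ++ [:: y; z]) ok12) p3) /=; last 2 first.
- by rewrite /qend /= last_cat.
- by rewrite -catA.
apply: Ideal_mulr; rewrite (mulE p1 p2) //=; apply: Ideal_mull; apply: Ideal_gen.
by exists (last x s1), y, z, ok3.
Qed.

End PathCoordinates.

Section LinearQuiver.
Variable n : nat.

Definition ord_le : rel 'I_n := fun a b => (a <= b)%N.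

Lemma linear_pathE x s : path (@linear_quiver n) x s ->
  [seq val y | y <- s] = iota x.+1 (size s).
Proof.
by elim: s x => //= y s IHs x /andP[/eqP xy /IHs ->]; rewrite xy.
Qed.

Lemma linear_path_last x s : path (@linear_quiver n) x s ->
  last x s = (x + size s)%N :> nat.
Proof.
elim: s x => [|y s IHs] x /=; first by rewrite addn0.
by move=> /andP[/eqP xy /IHs ->]; rewrite xy addSnnS.
Qed.

(** There is exactly one path from a to b when a <= b, and no relation. *)
Lemma linear_coordinates (k : comNzRingType) (n_gt0 : (0 < n)%N) :
  inhabited (coordinates (linear_alg k n_gt0) ord_le).
Proof.
have le_path (p : qpath (@linear_quiver n)) : ord_le (qstart p) (qend p).
  by case: p => -[x s] ok; rewrite /ord_le /qend linear_path_last // leq_addr.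
apply: pathalg_coordinates => //.
- by move=> x; apply: leqnn.
- move=> u v; rewrite /ord_le => uv; have [m Em] : exists m, v = (u + m)%N :> nat.
    by exists (v - u)%N; rewrite subnKC.
  elim: m u Em {uv} => [|m IHm] u Em.
    by exists (qtriv _ u) => //; apply: val_inj; rewrite /= Em addn0.
  have lt_u : (u.+1 < n)%N by apply: leq_ltn_trans (ltn_ord v); rewrite Em addnS ltnS leq_addr.
  have [|[[x s] ok] Es Ee] := IHm (Ordinal lt_u); first by rewrite Em addSnnS.
  rewrite /qstart /qend /= in ok Es Ee *; subst x.
  by exists (@QPath _ (@linear_quiver n) (u, Ordinal lt_u :: s)
    (introT andP (conj (eqxx _) ok))).
- move=> [[x s] oks] [[y t] okt]; rewrite /qstart /qend /= in oks okt * => _ Exy Est.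
  subst y; apply: val_inj => /=; congr (_, _); apply: (inj_map val_inj).
  rewrite (linear_pathE oks) (linear_pathE okt); congr iota; apply: (@addnI x).
  by rewrite -(linear_path_last oks) -(linear_path_last okt) Est.
Qed.

End LinearQuiver.

(** * Maximal sets of non-crossing arcs *)

Section ArcSystem.
Local Open Scope nat_scope.

(** A triangulation of the polygon with vertices 0, ..., n + 1, given by its
    diagonals and the distinguished side (0, n + 1); an arc v joins lft v and
    rgt v.  The last field is maximality: an arc (a, b) that crosses no arc of
    the system on either side belongs to it. *)
Record arc_system (n : nat) (V : finType) (lft rgt : V -> nat) : Prop := {
  arc_lt : forall v, (lft v).+1 < rgt v;
  arc_bound : forall v, rgt v <= n.+1;
  arc_inj : forall u v, lft u = lft v -> rgt u = rgt v -> u = v;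
  arc_nc : forall u v, lft u < lft v -> lft v < rgt u -> rgt v <= rgt u;
  arc_root : exists2 v, lft v = 0 & rgt v = n.+1;
  arc_max : forall a b, a.+1 < b -> b <= n.+1 ->
    (forall v, ~~ (lft v < a < rgt v) || (b <= rgt v)) ->
    (forall v, ~~ (a < lft v < b) || (rgt v <= b)) ->
    exists2 v, lft v = a & rgt v = b
}.

Variables (n : nat) (V : finType) (lft rgt : V -> nat).
Hypothesis arcs : arc_system n lft rgt.
Implicit Types u v w : V.

(** The arcs together with the sides of the polygon other than (0, n + 1). *)
Definition segment a b : bool :=
  (b == a.+1) || [exists v, (lft v == a) && (rgt v == b)].

Lemma segmentP a b : segment a b ->
  b = a.+1 \/ exists2 v, lft v = a & rgt v = b.
Proof.
case/orP=> [/eqP|/existsP[v /andP[/eqP ? /eqP ?]]]; first by left.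
by right; exists v.
Qed.

Lemma segment_arc v : segment (lft v) (rgt v).
Proof. by apply/orP; right; apply/existsP; exists v; rewrite !eqxx. Qed.

(** The third side of the triangle on v and (lft v, j): an arc crossing
    (j, rgt v) has to stay below v and outside (lft v, j), hence starts at lft v
    and ends strictly between j and rgt v. *)
Lemma fill_right v j : lft v < j < rgt v -> segment (lft v) j ->
  (forall w, lft w = lft v -> j < rgt w -> rgt v <= rgt w) ->
  segment j (rgt v).
Proof.
move=> jv sj no_w; have [->|jS] := eqVneq (rgt v) j.+1.
  by rewrite /segment eqxx.
have [| | w|w|w <- <-] := arc_max arcs (a := j) (b := rgt v).
- by lia.
- exact: arc_bound arcs v.
- have := arc_nc arcs (u := w) (v := v); have := no_w w.
  case/segmentP: sj => [Ej|[u Eu Ej]]; first by lia.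
  have := arc_nc arcs (u := u) (v := w); lia.
- have := arc_nc arcs (u := v) (v := w); lia.
- exact: segment_arc.
Qed.

(** The mirror image of [fill_right]. *)
Lemma fill_left v j : lft v < j < rgt v -> segment j (rgt v) ->
  (forall w, rgt w = rgt v -> lft w < j -> lft w <= lft v) ->
  segment (lft v) j.
Proof.
move=> jv sj no_w; have [->|jS] := eqVneq j (lft v).+1.
  by rewrite /segment eqxx.
have [| | w|w|w <- <-] := arc_max arcs (a := lft v) (b := j).
- by lia.
- by have := arc_bound arcs v; lia.
- have := arc_nc arcs (u := w) (v := v); lia.
- have := arc_nc arcs (u := v) (v := w); have := no_w w.
  case/segmentP: sj => [Ej|[u Eu Ej]]; first by lia.
  have := arc_nc arcs (u := w) (v := u); lia.
- exact: segment_arc.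
Qed.

(** The apex of the triangle below v is the largest end point of the segments
    that start at lft v and lie strictly below v. *)
Lemma apex_exists v : exists m, [&& lft v < m < rgt v, segment (lft v) m & segment m (rgt v)].
Proof.
pose P m := (lft v < m < rgt v) && segment (lft v) m.
have exP : exists m, P m.
  exists (lft v).+1; rewrite /P /segment eqxx /= andbT ltnSn.
  exact: (arc_lt arcs).
have ubP m : P m -> m <= rgt v by case/andP=> /andP[_ /ltnW].
case: (ex_maxnP exP ubP) => m /andP[mv sm] maxm; exists m; rewrite mv sm /=.
apply: fill_right => // w Ew mw; rewrite leqNgt; apply/negP => wv.
have /maxm : P (rgt w).
  by rewrite /P wv -{2}Ew segment_arc !andbT -Ew; apply/ltnW/(arc_lt arcs).
by rewrite leqNgt mw.
Qed.

(** The pairs of arcs joined by a non-zero path; dually, the pairs for which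
    there is a non-zero map from M(v) to M(u). *)
Definition arc_rel : rel V := fun u v =>
  [&& lft u <= lft v, rgt u <= rgt v & (lft u == lft v) || (rgt u == rgt v)].

(** The arrows from the left side of a triangle to its long side, and from the
    long side to the right side. *)
Definition left_arrow u v :=
  [&& lft u == lft v, rgt u < rgt v & segment (rgt u) (rgt v)].
Definition right_arrow u v :=
  [&& rgt u == rgt v, lft u < lft v & segment (lft u) (lft v)].

(** An arc w ending strictly between rgt u and rgt v would cross the third side
    of the triangle. *)
Lemma left_arrow_cover u v w : left_arrow u v ->
  lft w = lft u -> rgt u < rgt w -> rgt v <= rgt w.
Proof.
case/and3P=> /eqP Euv uv /segmentP[->//|[x Ex1 Ex2]] Ew uw.
have := arc_nc arcs (u := w) (v := x); have := arc_lt arcs u; lia.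
Qed.

Lemma right_arrow_cover u v w : right_arrow u v ->
  rgt w = rgt u -> lft u < lft w -> lft v <= lft w.
Proof.
case/and3P=> /eqP Euv uv /segmentP[->//|[x Ex1 Ex2]] Ew uw.
have := arc_nc arcs (u := x) (v := w); have := arc_lt arcs v; lia.
Qed.

Lemma left_arrow_exists u v : lft u = lft v -> rgt u < rgt v ->
  exists2 w, left_arrow u w & rgt w <= rgt v.
Proof.
move=> Euv uv.
pose P m := [exists w, [&& lft w == lft u, rgt u < rgt w & rgt w == m]].
have exP : exists m, P m.
  by exists (rgt v); apply/existsP; exists v; rewrite Euv uv !eqxx.
case: (ex_minnP exP) => m /existsP[w /and3P[/eqP Ew uw /eqP <-]] minm.
exists w; last first.
  by apply: minm; apply/existsP; exists v; rewrite Euv uv !eqxx.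
rewrite /left_arrow Ew eqxx uw /=; apply: fill_right => [||x Ex ux].
- by rewrite uw Ew andbT; apply/ltnW/(arc_lt arcs).
- by rewrite Ew segment_arc.
by apply: minm; apply/existsP; exists x; rewrite Ex Ew ux !eqxx.
Qed.

Lemma right_arrow_exists u v : rgt u = rgt v -> lft u < lft v ->
  exists2 w, right_arrow u w & lft w <= lft v.
Proof.
move=> Euv uv.
pose P m := [exists w, [&& rgt w == rgt u, lft u < lft w & lft w == m]].
have exP : exists m, P m.
  by exists (lft v); apply/existsP; exists v; rewrite Euv uv !eqxx.
case: (ex_minnP exP) => m /existsP[w /and3P[/eqP Ew uw /eqP <-]] minm.
exists w; last first.
  by apply: minm; apply/existsP; exists v; rewrite Euv uv !eqxx.
have wl := arc_lt arcs w.
rewrite /right_arrow Ew eqxx uw /=; apply: fill_left => [||x Ex xw].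
- by rewrite uw -Ew; lia.
- by rewrite -Ew segment_arc.
rewrite leqNgt; apply/negP => ux.
have : lft w <= lft x.
  by apply: minm; apply/existsP; exists x; rewrite Ex ux !eqxx.
by rewrite leqNgt xw.
Qed.

(** The two arrows lie in the same triangle: otherwise the third side of the
    first triangle would be an arc strictly between v and w. *)
Lemma left_right_arrow u v w : left_arrow u v -> right_arrow v w -> rgt u = lft w.
Proof.
move=> uv vw; have := arc_lt arcs w; have := right_arrow_cover vw.
case/and3P: uv => /eqP E1 uv /segmentP sg; case/and3P: vw => /eqP E2 vw _ cov wl.
have uw : rgt u <= lft w.
  by have := arc_nc arcs (u := u) (v := w); lia.
case: sg => [|[x Ex1 Ex2]]; first by lia.
have := cov x; have := arc_lt arcs u; lia.
Qed.

Lemma right_left_arrow u v w : right_arrow u v -> left_arrow v w -> False.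
Proof.
case/and3P=> /eqP E1 uv _; case/and3P=> /eqP E2 vw _.
have := arc_nc arcs (u := u) (v := w); have := arc_lt arcs v; lia.
Qed.

(** * The bound quiver of a triangulation *)

Section Paths.
Variables (e : rel V).
Hypothesis eE : forall u v, e u v = left_arrow u v || right_arrow u v.

Lemma arrow_mono u v : e u v ->
  [/\ lft u <= lft v, rgt u <= rgt v & lft u + rgt u < lft v + rgt v].
Proof.
rewrite eE => /orP[] /and3P[/eqP E lt _]; split; lia.
Qed.

Lemma path_mono u s : path e u s ->
  [/\ lft u <= lft (last u s), rgt u <= rgt (last u s) &
      (s != [::]) ==> (lft u + rgt u < lft (last u s) + rgt (last u s))].
Proof.
elim: s u => [|v s IHs] u //= /andP[/arrow_mono[? ? ?] /IHs[? ? _]]; split; lia.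
Qed.

Lemma path_nil u s : path e u s -> last u s = u -> s = [::].
Proof.
move=> /path_mono[_ _ H] E; apply/eqP; apply: contraLR H => ->.
by rewrite E ltnn.
Qed.

(** Existence of paths: step to the next arc with the same left (or right) end. *)
Lemma arc_path u v : arc_rel u v -> exists2 s, path e u s & last u s = v.
Proof.
have [m le_m] := ubnP (lft v + rgt v - (lft u + rgt u)).
elim: m u le_m => // m IHm u le_m /and3P[l_uv r_uv side].
have step w : e u w -> arc_rel w v -> exists2 s, path e u s & last u s = v.
  move=> euw wv; have [|s ps Es] := IHm w _ wv.
    by have [? ? ?] := arrow_mono euw; case/and3P: wv => ? ? _; lia.
  by exists (w :: s); rewrite /= ?euw.
have [E|neq] := eqVneq u v; first by exists [::].
case/orP: side => /eqP E.
  have uv : rgt u < rgt v.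
    by rewrite ltn_neqAle r_uv andbT; apply: contra neq => /eqP/(arc_inj arcs E)->.
  have [w uw wv] := left_arrow_exists E uv.
  apply: (step w); first by rewrite eE uw.
  by case/and3P: uw => /eqP E2 _ _; rewrite /arc_rel -E2 E leqnn wv eqxx.
have uv : lft u < lft v.
  by rewrite ltn_neqAle l_uv andbT; apply: contra neq => /eqP/(arc_inj arcs)/(_ E)->.
have [w uw wv] := right_arrow_exists E uv.
apply: (step w); first by rewrite eE uw orbT.
by case/and3P: uw => /eqP E2 _ _; rewrite /arc_rel -E2 E leqnn wv eqxx orbT.
Qed.

(** All arcs of such a path share an end point with u, and consecutive ones
    cover each other, so the next arc is forced. *)
Lemma arc_path_uniq u s t : path e u s -> path e u t -> last u s = last u t ->
  arc_rel u (last u s) -> s = t.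
Proof.
elim: s u t => [|v s IHs] u [|w t] //.
- by move=> _ pt E _; rewrite (path_nil pt).
- by move=> ps _ E _; rewrite (path_nil ps).
rewrite /= => /andP[uv ps] /andP[uw pt] E uz; have Evw : v = w; last first.
  subst w; congr (_ :: _); apply: (IHs v) => //.
  have [? ? ?] := arrow_mono uv; have [? ? _] := path_mono ps.
  case/and3P: uz => ? ? /orP[/eqP H|/eqP H]; apply/and3P; split=> //; lia.
have [z_l z_r _] := path_mono ps; have [y_l y_r _] := path_mono pt.
move: uz E z_l z_r y_l y_r; set z := last v s => uz <- z_l z_r y_l y_r.
have lv := arc_lt arcs v; have lw := arc_lt arcs w.
case/and3P: uz => lz rz /orP[]/eqP Ez.
  have Lu x : e u x -> lft x <= lft z -> left_arrow u x.
    by rewrite eE => /orP[//|/and3P[/eqP ? ? _]]; lia.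
  have vu := Lu _ uv z_l; have /and3P[/eqP Ev rv _] := vu.
  have wu := Lu _ uw y_l; have /and3P[/eqP Ew rw _] := wu.
  apply: (arc_inj arcs); first by lia.
  have := left_arrow_cover vu (w := w); have := left_arrow_cover wu (w := v); lia.
have Ru x : e u x -> rgt x <= rgt z -> right_arrow u x.
  by rewrite eE => /orP[/and3P[/eqP ? ? _]|//]; lia.
have vu := Ru _ uv z_r; have /and3P[/eqP Ev rv _] := vu.
have wu := Ru _ uw y_r; have /and3P[/eqP Ew rw _] := wu.
apply: (arc_inj arcs); last by lia.
have := right_arrow_cover vu (w := w); have := right_arrow_cover wu (w := v); lia.
Qed.

(** A right arrow is never followed by a left arrow, hence a path that moves
    both end points has exactly one turn, from a left arrow to a right arrow. *)
Lemma arc_path_split u s : path e u s -> ~~ arc_rel u (last u s) ->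
  exists s1 v w s2, [/\ s = s1 ++ v :: w :: s2,
    left_arrow (last u s1) v & right_arrow v w].
Proof.
elim: s u => [|v s IHs] u /=; first by rewrite /arc_rel !leqnn eqxx.
case/andP=> uv ps nuz; have [vz|nvz] := boolP (arc_rel v (last v s)); last first.
  by have [s1 [x [y [s2 [-> ? ?]]]]] := IHs v ps nvz; exists (v :: s1), x, y, s2.
have [? ? ?] := arrow_mono uv.
case: s ps vz nuz {IHs} => [|w s] /= ps vz nuz.
  case/negP: nuz; move: uv; rewrite eE => /orP[]/and3P[/eqP E ? _];
  rewrite /arc_rel E eqxx ?orbT; lia.
case/andP: ps => vw ps; have [? ? _] := path_mono ps.
exists [::], v, w, s; rewrite /=; move: uv vw; rewrite !eE.
case/orP=> uv /orP[] vw; split=> //.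
- case/and3P: uv vw vz nuz => /eqP ? ? _ /and3P[/eqP ? ? _]; rewrite /arc_rel; lia.
- by have := right_left_arrow uv vw.
- by have := right_left_arrow uv vw.
- case/and3P: uv vw vz nuz => /eqP ? ? _ /and3P[/eqP ? ? _]; rewrite /arc_rel; lia.
Qed.

Variables (rl : V -> V -> V -> bool) (k : comNzRingType) (v0 : V).
Hypothesis rl_triangle : forall u v w,
  lft u = lft v -> rgt u = lft w -> rgt v = rgt w -> rl u v w.
Hypothesis rl_rel : forall u v w, rl u v w -> e u v -> e v w -> ~~ arc_rel u w.

Lemma arc_coordinates :
  inhabited (coordinates (bound_quiver_alg k e v0 rl) arc_rel).
Proof.
apply: bound_coordinates => //.
- by move=> u; rewrite /arc_rel !leqnn eqxx.
- move=> [[u s] ps] [[v t] pt]; rewrite /qend /qstart /= in ps pt * => E uz.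
  subst v; have [? ? _] := path_mono ps; have [? ? _] := path_mono pt.
  by move: uz; rewrite /arc_rel; lia.
- move=> u v /arc_path[s ps <-].
  by exists (@QPath V e (u, s) ps).
- move=> [[u s] ps] [[v t] pt]; rewrite /qend /qstart /= in ps pt * => uz E1 E2.
  by subst v; apply: val_inj; congr (_, _); apply: (arc_path_uniq ps pt).
move=> [[u s] ps]; rewrite /qend /qstart /= in ps * => nuz.
have [s1 [v [w [s2 [Es uv vw]]]]] := arc_path_split ps nuz; subst s.
apply: ideal_path; have E := left_right_arrow uv vw.
by case/and3P: uv => /eqP ? _ _; case/and3P: vw => /eqP ? _ _; apply: rl_triangle.
Qed.

End Paths.
End ArcSystem.

(** * Interval modules over the linear quiver *)

Section IntervalModule.
Variables (k : comNzRingType) (n : nat) (A : algType k).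
Variable cA : coordinates A (@ord_le n).

Section Def.
Variables (I : finType) (lo hi : I -> nat).

Definition in_interval (i : I) (l : 'I_n) : bool := (lo i <= l < hi i)%N.

(** The sum over i of the modules with basis the vertices l in [lo i, hi i).  The
    type carries the coordinates, from which its module structure is inferred. *)
Definition intmod of coordinates A (@ord_le n) : Type :=
  {ffun {x : I * 'I_n | in_interval x.1 x.2} -> k}.
Local Notation M := (intmod cA).
HB.instance Definition _ := GRing.Zmodule.on M.

(** Coefficients extended by zero outside the intervals, so that sums can run over
    all indices and vertices. *)
Definition get (t : M) i l : k := oapp t 0 (insub (i, l)).
Definition mk (F : I -> 'I_n -> k) : M := [ffun x => F (val x).1 (val x).2].

Lemma get_mk F i l : get (mk F) i l = if in_interval i l then F i l else 0.
Proof.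
by rewrite /get; case: insubP => [x /= -> /= Ex|/negPf /= ->] //=; rewrite ffunE /= Ex.
Qed.

Lemma get_out t i l : ~~ in_interval i l -> get t i l = 0.
Proof. by move=> nil; rewrite /get insubN. Qed.

Lemma get_neq0 t i l : get t i l != 0 -> in_interval i l.
Proof. by apply: contraR => /get_out ->. Qed.

Lemma get_ext t t' : (forall i l, in_interval i l -> get t i l = get t' i l) ->
  t = t'.
Proof.
move=> tt'; apply/ffunP => -[[i l] il]; have := tt' i l il.
by rewrite /get insubT.
Qed.

Lemma getD t t' i l : get (t + t') i l = get t i l + get t' i l.
Proof. by rewrite /get; case: insub => [x|] /=; rewrite ?addr0 // ffunE. Qed.

Lemma get0 i l : get 0 i l = 0.
Proof. by rewrite /get; case: insub => [x|] //=; rewrite ffunE. Qed.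

Lemma get_sum (J : Type) (s : seq J) (P : pred J) (F : J -> M) i l :
  get (\sum_(j <- s | P j) F j) i l = \sum_(j <- s | P j) get (F j) i l.
Proof. by apply: (big_morph (fun t => get t i l)) => [t t'|]; rewrite ?getD ?get0. Qed.

(** Right multiplication, written on the left because the scalars are in the
    converse algebra. *)
Definition act (a : A^c) (t : M) : M := mk (fun i l => \sum_b get t i b * cA a b l).

Lemma get_act a t i l : get (act a t) i l =
  if in_interval i l then \sum_b get t i b * cA a b l else 0.
Proof. exact: get_mk. Qed.

Fact act_A a b t : act a (act b t) = act (a * b) t.
Proof.
apply: get_ext => i l il; rewrite !get_act il.
under eq_bigr => c _ do rewrite get_act.
transitivity (\sum_c \sum_d (get t i d * cA b d c) * cA a c l).
  apply: eq_bigr => c _; rewrite -mulr_suml.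
  case: ifPn => // nic; rewrite mul0r mulr_suml big1 // => d _.
  apply/eqP; apply: contraR nic => H.
  have /get_neq0 : get t i d != 0 by apply: contraNneq H => ->; rewrite !mul0r.
  have /coord_neq0 : cA b d c != 0 by apply: contraNneq H => ->; rewrite mulr0 mul0r.
  have /coord_neq0 : cA a c l != 0 by apply: contraNneq H => ->; rewrite mulr0.
  move: il; rewrite /in_interval /ord_le; lia.
rewrite exchange_big; apply: eq_bigr => d _ /=.
have [dl|/negPf ndl] := boolP (ord_le d l).
  by rewrite [cA (_ * _) _ _](coordM cA) // mulr_sumr; apply: eq_bigr => c _; rewrite mulrA.
rewrite [cA (_ * _) _ _](coord_out cA) ?ndl // mulr0 big1 // => c _.
apply/eqP/negP => /negP H; move: ndl; rewrite /ord_le.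
have /coord_neq0 : cA b d c != 0 by apply: contraNneq H => ->; rewrite mulr0 mul0r.
have /coord_neq0 : cA a c l != 0 by apply: contraNneq H => ->; rewrite mulr0.
rewrite /ord_le; lia.
Qed.

Fact act_1 : left_id 1 act.
Proof.
move=> t; apply: get_ext => i l il; rewrite get_act il (bigD1 l) //= big1.
  by rewrite addr0 (coord1 cA) eqxx mulr1.
by move=> b bl; rewrite (coord1 cA) (negPf bl) mulr0.
Qed.

Fact act_Dr : right_distributive act +%R.
Proof.
move=> a t t'; apply: get_ext => i l il; rewrite getD !get_act il -big_split.
by apply: eq_bigr => b _; rewrite getD mulrDl.
Qed.

Fact act_Dl t : {morph act^~ t : a b / a + b}.
Proof.
move=> a b; apply: get_ext => i l il; rewrite getD !get_act il -big_split.
by apply: eq_bigr => c _; rewrite (coordD cA) mulrDr.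
Qed.

HB.instance Definition _ := GRing.Zmodule_isLmodule.Build A^c M
  act_A act_1 act_Dr act_Dl.

Lemma getZ (a : A^c) (t : M) i l : get (a *: t) i l =
  if in_interval i l then \sum_b get t i b * cA a b l else 0.
Proof. exact: get_act. Qed.

Lemma get_scalar (c : k) (t : M) i l : get ((c%:A : A^c) *: t) i l = c * get t i l.
Proof.
rewrite getZ; case: ifPn => [il|nil]; last by rewrite get_out ?mulr0.
rewrite (bigD1 l) //= big1 ?addr0 => [|b bl]; rewrite (coord_scalar cA).
  by rewrite eqxx mulr1 mulrC.
by rewrite (negPf bl) !mulr0.
Qed.

End Def.
End IntervalModule.

Section IntervalMaps.
Variables (k : comNzRingType) (n : nat) (A : algType k).
Variable cA : coordinates A (@ord_le n).
Local Notation M lo hi := (intmod lo hi cA).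

Section Maps.
Variables (I J : finType) (lo hi : I -> nat) (lo' hi' : J -> nat).
Variable C : I -> J -> k.

Definition matrix_fun (t : M lo hi) : M lo' hi' :=
  mk cA lo' hi' (fun j l => \sum_i C i j * get t i l).

Lemma get_matrix_fun t j l : get (matrix_fun t) j l =
  if in_interval lo' hi' j l then \sum_i C i j * get t i l else 0.
Proof. exact: get_mk. Qed.

(** The natural map between the interval modules of i and j is the identity on
    the vertices common to both.  When the intervals meet, it is a module map
    exactly under these inequalities, as the image must be a quotient of the
    first and a submodule of the second. *)
Definition hom_matrix : Prop :=
  forall i j, C i j != 0 -> (lo' j <= lo i)%N && (hi' j <= hi i)%N.

Lemma matrix_fun_linear : hom_matrix -> linear matrix_fun.
Proof.
move=> homC a t t'; apply: get_ext => j l jl.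
rewrite getD getZ !get_matrix_fun jl.
under eq_bigr => i _ do rewrite getD mulrDr getZ.
rewrite big_split; congr (_ + _).
under [RHS]eq_bigr => b _ do rewrite get_matrix_fun.
transitivity (\sum_i \sum_b C i j * get t i b * cA a b l).
  apply: eq_bigr => i _; case: ifPn => [il|nil].
    by rewrite mulr_sumr; apply: eq_bigr => b _; rewrite mulrA.
  rewrite mulr0 big1 // => b _; apply/eqP; apply: contraR nil => H.
  have /homC : C i j != 0 by apply: contraNneq H => ->; rewrite !mul0r.
  have /get_neq0 : get t i b != 0 by apply: contraNneq H => ->; rewrite mulr0 mul0r.
  have /coord_neq0 : cA a b l != 0 by apply: contraNneq H => ->; rewrite mulr0.
  move: jl; rewrite /in_interval /ord_le; lia.
rewrite exchange_big; apply: eq_bigr => b _ /=; rewrite -mulr_suml.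
case: ifPn => // njb; rewrite mul0r mulr_suml big1 // => i _.
apply/eqP; apply: contraR njb => H.
have /homC : C i j != 0 by apply: contraNneq H => ->; rewrite !mul0r.
have /get_neq0 : get t i b != 0 by apply: contraNneq H => ->; rewrite mulr0 mul0r.
have /coord_neq0 : cA a b l != 0 by apply: contraNneq H => ->; rewrite mulr0.
move: jl; rewrite /in_interval /ord_le; lia.
Qed.

Definition matrix_map (homC : hom_matrix) : {linear M lo hi -> M lo' hi'} :=
  linear_map (matrix_fun_linear homC).

Lemma matrix_mapE (homC : hom_matrix) : matrix_map homC =1 matrix_fun.
Proof. by []. Qed.

End Maps.

Arguments matrix_fun {I J lo hi lo' hi'} C t.

Section Generators.
Variables (I : finType) (lo hi : I -> nat).
Implicit Types t : M lo hi.

(** The interval module with index i is generated by its first vertex. *)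
Definition gen (i : I) : M lo hi :=
  mk cA lo hi (fun i' l => ((i' == i) && (l == lo i :> nat))%:R).

(** The row lo i of this element is the i-th component of t. *)
Definition gen_coef (i : I) t : A :=
  elt_of cA (fun a b => (a == lo i :> nat)%:R * get t i b).

Lemma gen_coefE i t a b : cA (gen_coef i t) a b =
  if (a <= b)%N then (a == lo i :> nat)%:R * get t i b else 0.
Proof. exact: coord_elt. Qed.

Lemma gen_span t : t = \sum_i (gen_coef i t : A^c) *: gen i.
Proof.
apply: get_ext => i l il; rewrite get_sum (bigD1 i) //= big1 ?addr0 => [|j ji].
  rewrite getZ il.
  have lo_n : (lo i < n)%N.
    by apply: leq_ltn_trans (ltn_ord l); case/andP: il.
  rewrite (bigD1 (Ordinal lo_n)) //= big1 ?addr0 => [|b blo].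
    rewrite get_mk gen_coefE /=; move: (il); rewrite /in_interval /= !eqxx leqnn.
    by case/andP=> lo_l l_hi; rewrite lo_l (leq_ltn_trans lo_l l_hi) !mul1r.
  rewrite get_mk gen_coefE; case: ifP => _; last by rewrite mul0r.
  have -> : (b == lo i :> nat) = false.
    by apply: contraNF blo => /eqP Eb; apply/eqP/val_inj.
  by rewrite andbF mul0r.
rewrite getZ il big1 // => b _; rewrite get_mk; case: ifP => _; last by rewrite mul0r.
by rewrite eq_sym (negPf ji) mul0r.
Qed.

End Generators.

(** A map is determined by the images of the generators, and the image of the
    i-th one is concentrated at the vertex lo i.  The inequality between the
    upper bounds holds because the path from lo i to hi i kills the generator. *)
Lemma matrix_mapP (I J : finType) (lo hi : I -> nat) (lo' hi' : J -> nat)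
    (phi : {linear M lo hi -> M lo' hi'}) : (forall j, hi' j <= n)%N ->
  exists2 C : I -> J -> k,
    forall i j, C i j != 0 -> [&& lo' j <= lo i, lo i < hi' j & hi' j <= hi i]%N
    & phi =1 matrix_fun C.
Proof.
move=> hi_n.
pose C i j := \sum_(l : 'I_n | l == lo i :> nat) get (phi (gen lo hi i)) j l.
exists C => [i j|t].
  rewrite /C; have [lo_n|n_lo] := ltnP (lo i) n; last first.
    by rewrite big1 ?eqxx // => l /eqP El; have := ltn_ord l; lia.
  rewrite (big_pred1 (Ordinal lo_n)) => [|l]; last first.
    by apply/eqP/eqP => [El|-> //]; apply: val_inj.
  move=> H; have := get_neq0 H; rewrite /in_interval /= => /andP[lo_lo' lo_hi].
  rewrite lo_lo' lo_hi /= leqNgt; apply/negP => hi_hi'.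
  have hi_lt : (hi i < n)%N by apply: leq_trans hi_hi' (hi_n j).
  have [lo_lt|hi_lo] := ltnP (lo i) (hi i); last first.
    have G0 : gen lo hi i = 0.
      apply: get_ext => i' l; rewrite get_mk get0 => il; rewrite il.
      case: eqP => //= Ei; move: il; rewrite Ei /in_interval; lia.
    by rewrite G0 linear0 get0 eqxx in H.
  (* the path from lo i to hi i *)
  pose a : A := elt_of cA (fun x y => ((x == lo i :> nat) && (y == hi i :> nat))%:R).
  have G0 : (a : A^c) *: gen lo hi i = 0.
    apply: get_ext => i' l; rewrite getZ get0 => il; rewrite il big1 // => b _.
    rewrite get_mk coord_elt; case: ifP => _; rewrite ?mul0r //.
    case: eqP => [Ei|]; last by rewrite mul0r.
    case: ifP => _; last by rewrite mulr0.
    have -> : (l == hi i :> nat) = false.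
      by apply/negP => /eqP El; move: il; rewrite Ei /in_interval; lia.
    by rewrite andbF mulr0.
  have phiZ : phi ((a : A^c) *: gen lo hi i) = (a : A^c) *: phi (gen lo hi i).
    by rewrite linearZ.
  have := congr1 (fun t => get t j (Ordinal hi_lt)) phiZ.
  rewrite /= G0 linear0 get0 getZ; case: ifPn => [_|]; last by rewrite /in_interval /=; lia.
  rewrite (bigD1 (Ordinal lo_n)) //= big1 ?addr0 => [|b blo].
    rewrite coord_elt /ord_le /= (ltnW lo_lt) !eqxx mulr1 => H0.
    by rewrite -H0 eqxx in H.
  rewrite coord_elt; case: ifP => _; last by rewrite mulr0.
  case: eqP => [Eb|]; last by rewrite mulr0.
  by case/eqP: blo; apply: val_inj.
apply: get_ext => j l jl; rewrite get_matrix_fun jl {1}(gen_span t) linear_sum.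
rewrite get_sum; apply: eq_bigr => i _ /=; rewrite linearZ getZ jl /C mulr_suml.
rewrite [RHS]big_mkcond; apply: eq_bigr => b _; rewrite gen_coefE.
case: eqP => [Eb|_]; last by rewrite mul0r; case: ifP; rewrite mulr0.
case: ifPn => [_|nbl]; first by rewrite mul1r.
rewrite (@get_out _ _ _ _ _ _ _ t) ?mulr0 //.
by rewrite /in_interval -Eb; lia.
Qed.

End IntervalMaps.
Arguments matrix_fun {k n A cA I J lo hi lo' hi'} C t : rename.

(** * Homological properties of interval modules *)

(** Extending maps along P1 -> P0 is the surjectivity of Hom(P0, L) -> Hom(P1, L).
    Given an extension E of N by L, lift P0 -> N to h : P0 -> E; its restriction
    to P1 has values in L and extends to psi on P0, and h - psi factors through
    a section N -> E. *)
Lemma ext1_vanishes_extension (R : pzRingType) (N L P1 P0 : lmodType R)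
    (f : {linear P1 -> P0}) (g : {linear P0 -> N}) :
  projective P0 -> short_exact f g ->
  (forall phi : {linear P1 -> L}, exists psi : {linear P0 -> L}, psi \o f =1 phi) ->
  ext1_vanishes N L.
Proof.
move=> projP0 [inj_f surj_g fg] ext E i p [inj_i surj_p ip].
have [h ph] := projP0 _ _ p g surj_p.
have phi_ex x : exists y, i y = h (f x).
  by apply/ip; have /= -> := ph (f x); apply/fg; exists x.
pose phi x := projT1 (cid (phi_ex x)).
have phiE x : i (phi x) = h (f x) by rewrite /phi; case: cid.
have lin_phi : linear phi.
  by move=> a x y; apply: inj_i; rewrite linearP !phiE !linearP.
have [psi psif] := ext (linear_map lin_phi).
pose h' x := h x - i (psi x).
have h'f x : h' (f x) = 0.
  by rewrite /h'; have /= -> := psif x; rewrite linear_mapE phiE subrr.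
have ph' x : p (h' x) = g x.
  rewrite /h' linearB; have /= -> := ph x.
  by have -> : p (i (psi x)) = 0; [apply/ip; exists (psi x) | rewrite subr0].
have lin_h' : linear h'.
  by move=> a x y; rewrite /h' (linearP h) (linearP psi) (linearP i) scalerBr opprD addrACA.
have h'_eq x y : g x = g y -> h' x = h' y.
  move=> gxy; have /fg[z zE] : g (x - y) = 0 by rewrite linearB gxy subrr.
  have := h'f z; rewrite zE -[x - y]addrC -scaleN1r lin_h' scaleN1r addrC.
  by move/eqP; rewrite subr_eq0 => /eqP.
pose s y := h' (projT1 (cid (surj_g y))).
have gs y : g (projT1 (cid (surj_g y))) = y by case: cid.
have lin_s : linear s.
  by move=> a x y; rewrite /s -lin_h'; apply: h'_eq; rewrite linearP !gs.
by exists (linear_map lin_s) => y; rewrite linear_mapE /s ph' gs.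
Qed.

Section IntervalModuleProperties.
Variables (k : comNzRingType) (n : nat) (A : algType k).
Variable cA : coordinates A (@ord_le n).
Local Notation M lo hi := (intmod lo hi cA).

Lemma intmod_fin_gen (I : finType) (lo hi : I -> nat) : fin_gen (M lo hi).
Proof.
pose g (u : {ffun 'I_#|I| -> (A^c)^o}) : M lo hi :=
  \sum_i (u (enum_rank i) : A^c) *: gen cA lo hi i.
have lin_g : linear g.
  move=> a u u'; rewrite /g scaler_sumr -big_split; apply: eq_bigr => i _ /=.
  by rewrite !ffunE scalerDl scalerA.
exists #|I|, (linear_map lin_g) => t.
exists [ffun j => gen_coef (enum_val j) t].
rewrite linear_mapE /g [RHS](gen_span _); apply: eq_bigr => i _.
by rewrite ffunE enum_rankK.
Qed.

(** An interval module whose interval ends at n is some P(a), which sits in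
    A as the elements whose only non-zero row is the row a. *)
Lemma intmod_projective (I : finType) (lo hi : I -> nat) :
  (forall i, hi i = n) -> projective (M lo hi).
Proof.
move=> hi_n.
have lin_pi i : linear (gen_coef i : M lo hi -> (A^c)^o).
  move=> a t t'; apply: (coord_ext (cA := cA)) => x y xy.
  rewrite gen_coefE getD mulrDr [(x <= y)%N]xy [RHS](coordD cA) gen_coefE.
  rewrite [(x <= y)%N]xy; congr (_ + _).
  rewrite [RHS](coordM cA) // getZ.
  under [RHS]eq_bigr => z _ do rewrite gen_coefE.
  case: eqP => [Ex|_]; last first.
    by rewrite mul0r big1 // => z _; rewrite mul0r; case: ifP; rewrite mul0r.
  rewrite mul1r ifT; last by rewrite /in_interval -Ex hi_n ltn_ord andbT.
  apply: eq_bigr => z _; rewrite mul1r; case: ifPn => // nxz.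
  by rewrite get_out // /in_interval -Ex; lia.
apply: (@projective_dual_basis _ _
  [seq (gen cA lo hi i, linear_map (lin_pi i)) | i <- enum I]) => t.
rewrite big_map big_enum /= [LHS](gen_span _).
by apply: eq_bigr => i _; rewrite linear_mapE.
Qed.

(** Componentwise natural maps between two sums with the same index set. *)
Definition inclusion_matrix (I : finType) (i j : I) : k := (i == j)%:R.

Lemma get_inclusion (I : finType) (lo hi lo' hi' : I -> nat) (t : M lo hi) i l :
  get (@matrix_fun _ _ _ cA I I lo hi lo' hi' (@inclusion_matrix I) t) i l =
  if in_interval lo' hi' i l then get t i l else 0.
Proof.
rewrite get_matrix_fun; case: ifP => // il.
rewrite (bigD1 i) //= big1 ?addr0 => [|j ji]; rewrite /inclusion_matrix.
  by rewrite eqxx mul1r.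
by rewrite (negPf ji) mul0r.
Qed.

(** The interval [lo, hi) is the complement of [hi, n) in [lo, n). *)
Lemma intmod_presentation (I : finType) (lo hi : I -> nat) :
    (forall i, lo i <= hi i <= n)%N ->
  exists (f : {linear M hi (fun=> n) -> M lo (fun=> n)})
         (g : {linear M lo (fun=> n) -> M lo hi}),
    [/\ f =1 matrix_fun (inclusion_matrix (I := I)),
        g =1 matrix_fun (inclusion_matrix (I := I)) & short_exact f g].
Proof.
move=> lo_hi.
have hom_f : hom_matrix hi (fun=> n) lo (fun=> n) (inclusion_matrix (I := I)).
  move=> i j; rewrite /inclusion_matrix; case: (i =P j) => [-> _|]; last by rewrite eqxx.
  by case/andP: (lo_hi j) => -> _; rewrite leqnn.
have hom_g : hom_matrix lo (fun=> n) lo hi (inclusion_matrix (I := I)).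
  move=> i j; rewrite /inclusion_matrix; case: (i =P j) => [-> _|]; last by rewrite eqxx.
  by case/andP: (lo_hi j) => _ ->; rewrite leqnn.
exists (matrix_map cA hom_f), (matrix_map cA hom_g); split=> //; split.
- move=> t t'; rewrite !matrix_mapE => E; apply: get_ext => i l il.
  have := congr1 (fun x => get x i l) E; rewrite !get_inclusion.
  suff -> : in_interval lo (fun=> n) i l by [].
  by move: (lo_hi i) il; rewrite /in_interval /=; lia.
- move=> t; exists (mk cA lo (fun=> n) (get t)); rewrite matrix_mapE.
  apply: get_ext => i l il; rewrite get_inclusion il get_mk ifT //.
  move: (lo_hi i) il; rewrite /in_interval /=; lia.
move=> t; split=> [gt0|[t' <-]]; last first.
  rewrite !matrix_mapE; apply: get_ext => i l il.
  rewrite !get_inclusion il get0 ifT; last first.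
    by move: il (ltn_ord l); rewrite /in_interval /=; lia.
  by rewrite get_out //; move: il; rewrite /in_interval /=; lia.
exists (mk cA hi (fun=> n) (get t)); rewrite matrix_mapE.
apply: get_ext => i l il; rewrite get_inclusion il get_mk; case: ifPn => // nil.
have := congr1 (fun x => get x i l) gt0; rewrite matrix_mapE get_inclusion get0.
by rewrite ifT // /in_interval; move: nil il; rewrite /in_interval /=; lia.
Qed.

Lemma intmod_pdim_le1 (I : finType) (lo hi : I -> nat) :
  (forall i, lo i <= hi i <= n)%N -> pdim_le1 (M lo hi).
Proof.
move=> /intmod_presentation[f [g [_ _ fg]]].
by exists _, _, f, g; split=> //; apply: intmod_projective.
Qed.

(** By the second hypothesis a matrix of maps from the P(hi i) is also a matrix
    of maps from the P(lo i). *)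
Lemma intmod_ext1 (I : finType) (lo hi : I -> nat) :
    (forall i, lo i <= hi i <= n)%N ->
    (forall i j, lo j <= hi i -> hi i < hi j -> lo j <= lo i)%N ->
  ext1_vanishes (M lo hi) (M lo hi).
Proof.
move=> lo_hi nc; have [f [g [fE gE fg]]] := intmod_presentation lo_hi.
apply: ext1_vanishes_extension fg _ => [|phi]; first exact: intmod_projective.
have [|C CP phiE] := @matrix_mapP _ _ _ cA _ _ _ _ lo hi phi.
  by move=> i; case/andP: (lo_hi i).
have homC : hom_matrix lo (fun=> n) lo hi C.
  move=> i j /CP/and3P[? ? ->]; rewrite andbT; exact: nc.
exists (matrix_map cA homC) => t; rewrite /= fE phiE matrix_mapE.
apply: get_ext => j l jl; rewrite !get_matrix_fun jl; apply: eq_bigr => i _.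
have [->|Cij] := eqVneq (C i j) 0; first by rewrite !mul0r.
rewrite get_inclusion; case: ifPn => // nil.
rewrite [in RHS]get_out //; move: (lo_hi i) nil; rewrite /in_interval /=; lia.
Qed.

(** Summands with an empty interval vanish, so they need not occur in the list
    of intervals [lo i, hi i). *)
Lemma intmod_in_add (I J : finType) (lo hi : I -> nat) (lo' hi' : J -> nat) :
    I ->
    (forall j, hi' j <= lo' j \/ exists i, lo i = lo' j /\ hi i = hi' j)%N ->
  in_add (M lo hi) (M lo' hi').
Proof.
move=> i0 JI.
have cP j : exists i, (lo' j < hi' j)%N -> lo i = lo' j /\ hi i = hi' j.
  by case: (JI j) => [lh|[i iE]]; [exists i0; rewrite ltnNge lh | exists i].
pose c j := projT1 (cid (cP j)).
have cE j : (lo' j < hi' j)%N -> lo (c j) = lo' j /\ hi (c j) = hi' j.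
  by rewrite /c; case: cid.
pose C j (j' : J) i : k := [&& j' == j, i == c j & (lo' j < hi' j)%N]%:R.
have homC j : hom_matrix lo' hi' lo hi (C j).
  move=> j' i; rewrite /C; case: and3P; rewrite ?eqxx // => -[/eqP -> /eqP -> /cE[-> ->]].
  by rewrite !leqnn.
have homC' j : hom_matrix lo hi lo' hi' (fun i j' => C j j' i).
  move=> j' i; rewrite /C; case: and3P; rewrite ?eqxx // => -[/eqP -> /eqP -> /cE[-> ->]].
  by rewrite !leqnn.
pose f (t : M lo' hi') : {ffun 'I_#|J| -> M lo hi} :=
  [ffun r => matrix_map cA (homC (enum_val r)) t].
have lin_f : linear f.
  by move=> a t t'; apply/ffunP => r; rewrite !ffunE linearP.
pose g (u : {ffun 'I_#|J| -> M lo hi}) : M lo' hi' :=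
  \sum_j matrix_map cA (homC' j) (u (enum_rank j)).
have lin_g : linear g.
  move=> a u u'; rewrite /g scaler_sumr -big_split; apply: eq_bigr => j _ /=.
  by rewrite !ffunE linearP.
exists #|J|, (linear_map lin_f), (linear_map lin_g) => t.
rewrite !linear_mapE /g; apply: get_ext => j l jl; rewrite get_sum.
have j_lt : (lo' j < hi' j)%N by move: jl; rewrite /in_interval /=; lia.
rewrite (bigD1 j) //= big1 ?addr0 => [|j' j'j].
  rewrite ffunE enum_rankK !matrix_mapE get_matrix_fun jl.
  rewrite (bigD1 (c j)) //= big1 ?addr0 => [|i ij].
    rewrite /C !eqxx j_lt mul1r get_matrix_fun /in_interval.
    have [-> ->] := cE j j_lt; rewrite -/(in_interval lo' hi' j l) jl.
    rewrite (bigD1 j) //= big1 ?addr0 => [|j' j'j].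
      by rewrite !eqxx mul1r.
    by rewrite (negPf j'j) mul0r.
  by rewrite /C (negPf ij) andbF mul0r.
rewrite matrix_mapE get_matrix_fun jl big1 // => i _.
by rewrite /C eq_sym (negPf j'j) mul0r.
Qed.

End IntervalModuleProperties.

(** * The tilting module of a triangulation *)

Section Coresolution.
Variables (n : nat) (V : finType) (lft rgt : V -> nat).
Hypothesis arcs : arc_system n lft rgt.
Implicit Types u v w : V.

(** Vertices of the linear quiver are numbered from 0, so the vertex l stands for
    the polygon vertex l + 1 and M(v) lives on lft v <= l < rgt v - 1. *)
Definition support_end v := (rgt v).-1.

Definition apex v : nat := projT1 (cid (apex_exists arcs v)).

Lemma apexP v : [/\ (lft v < apex v < rgt v)%N, segment lft rgt (lft v) (apex v)
  & segment lft rgt (apex v) (rgt v)].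
Proof. by rewrite /apex; case: cid => m /= /and3P[]. Qed.

Definition inside (a : 'I_n) v : bool := in_interval lft support_end v a.

Lemma insideE a v : inside a v = (lft v < a.+1 < rgt v)%N.
Proof. by rewrite /inside /in_interval /support_end; have := arc_lt arcs v; lia. Qed.

Definition sub_arc u v : bool := (lft v <= lft u)%N && (rgt u <= rgt v)%N.

Lemma sub_arc_total a u v : inside a u -> inside a v -> sub_arc u v || sub_arc v u.
Proof.
rewrite !insideE /sub_arc; have := arc_nc arcs (u := u) (v := v).
have := arc_nc arcs (u := v) (v := u); lia.
Qed.

Lemma sub_arc_anti u v : sub_arc u v -> sub_arc v u -> u = v.
Proof. by move=> /andP[? ?] /andP[? ?]; apply: (arc_inj arcs); lia. Qed.

(** An arc below v whose interior contains the apex of v would cross one of the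
    two lower sides of the triangle. *)
Lemma sub_arc_apex u v : sub_arc u v ->
  [\/ u = v, (rgt u <= apex v)%N | (apex v <= lft u)%N].
Proof.
move=> /andP[vu uv]; have [um|mu] := leqP (rgt u) (apex v); first by apply: Or32.
have [mu'|um] := leqP (apex v) (lft u); first by apply: Or33.
apply: Or31; have [mv sl sr] := apexP v; apply: (arc_inj arcs).
  case/segmentP: sl => [E|[x Ex1 Ex2]]; first by lia.
  have := arc_nc arcs (u := x) (v := u); lia.
case/segmentP: sr => [E|[x Ex1 Ex2]]; first by lia.
have := arc_nc arcs (u := u) (v := x); lia.
Qed.

(** The two lower sides of the triangle below v. *)
Definition is_child v u : bool :=
  (lft u == lft v) && (rgt u == apex v) || (lft u == apex v) && (rgt u == rgt v).

Lemma is_child_sub v u : is_child v u -> sub_arc u v /\ u <> v.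
Proof.
have [/andP[lm mr] _ _] := apexP v; rewrite /is_child /sub_arc => uv.
by split=> [|E]; move: uv; rewrite ?E; lia.
Qed.

(** The interior vertices of v other than the apex are interior to exactly one of
    the two lower sides. *)
Lemma child_exists (a : 'I_n) v : inside a v -> a.+1 <> apex v ->
  exists u, [/\ inside a u, is_child v u &
    forall u', inside a u' && is_child v u' = (u' == u)].
Proof.
rewrite insideE => av am; have [/andP[lm mr] sl sr] := apexP v.
have [am'|ma] := ltnP a.+1 (apex v).
  case/segmentP: sl => [E|[x Ex1 Ex2]]; first by lia.
  have ax : inside a x by rewrite insideE; lia.
  exists x; rewrite ax /is_child Ex1 Ex2 !eqxx; split=> // u'.
  apply/andP/eqP => [[]|->]; last by rewrite ax Ex1 Ex2 !eqxx.
  by rewrite insideE => au' cu'; apply: (arc_inj arcs); lia.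
case/segmentP: sr => [E|[x Ex1 Ex2]]; first by lia.
have ax : inside a x by rewrite insideE; lia.
exists x; rewrite ax /is_child Ex1 Ex2 !eqxx orbT; split=> // u'.
apply/andP/eqP => [[]|->]; last by rewrite ax Ex1 Ex2 !eqxx orbT.
by rewrite insideE => au' cu'; apply: (arc_inj arcs); lia.
Qed.

Lemma child_none (a : 'I_n) v u : a.+1 = apex v -> inside a u -> ~~ is_child v u.
Proof.
by move=> am; rewrite insideE /is_child am; lia.
Qed.

Lemma sub_child (a : 'I_n) v u w : inside a u -> is_child v u -> inside a w ->
  sub_arc w u = sub_arc w v && (w != v).
Proof.
move=> au uv aw; have [/andP[ulv urv] neq] := is_child_sub uv.
apply/idP/andP => [wu|[wv /eqP wneq]].
  split; first by move: wu; rewrite /sub_arc; lia.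
  apply: contra_notN neq => /eqP Ew; apply: sub_arc_anti; last by rewrite -Ew.
  by rewrite /sub_arc ulv.
have [//|wm|mw] := sub_arc_apex wv; move: au aw uv wv wm || move: au aw uv wv mw;
  rewrite !insideE /is_child /sub_arc; lia.
Qed.

Variables (k : comNzRingType) (A : algType k) (cA : coordinates A (@ord_le n)).
Local Notation M lo hi := (intmod lo hi cA).
Local Notation T := (M lft support_end).

(** The middle and right terms of the coresolution of A.  For each vertex a they
    have one summand for each arc w around a: M(w) in the middle and N(a, w) on
    the right, where N(a, w) is the left lower side of w if a is at most the
    apex, and w itself otherwise.  The intervals of the pairs (a, w) with w not
    around a are made empty. *)
Definition lo_mid (p : 'I_n * V) := lft p.2.
Definition hi_mid (p : 'I_n * V) := if inside p.1 p.2 then support_end p.2 else 0%N.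
Definition hi_coker (p : 'I_n * V) :=
  if ~~ inside p.1 p.2 then 0%N
  else if (p.1 < apex p.2)%N then (apex p.2).-1 else support_end p.2.

Lemma in_mid a w l : in_interval lo_mid hi_mid (a, w) l = inside a w && inside l w.
Proof.
rewrite /in_interval /hi_mid /lo_mid /=; case: ifP => _; last by lia.
by [].
Qed.

Lemma in_coker a w l : in_interval lo_mid hi_coker (a, w) l =
  [&& inside a w, inside l w & (a < apex w)%N ==> (l.+1 < apex w)%N].
Proof.
have [/andP[lm mr] _ _] := apexP w.
rewrite /in_interval /hi_coker /lo_mid /=.
case: ifP; last case: ifP; rewrite !insideE /support_end; lia.
Qed.

(** The component (a, w) of the map is the difference between the component w and
    the component of the next smaller arc around a, both mapped to N(a, w); the
    natural map between these two components has target N(a, w).  If a is the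
    apex there is no smaller arc, and the component w alone is mapped. *)
Definition coker_matrix (p q : 'I_n * V) : k :=
  (p.1 == q.1)%:R * ((p.2 == q.2)%:R -
    [&& inside q.1 p.2, inside q.1 q.2 & is_child q.2 p.2]%:R).

Lemma coker_matrix_hom : hom_matrix lo_mid hi_mid lo_mid hi_coker coker_matrix.
Proof.
move=> [a w'] [b w]; rewrite /coker_matrix /hi_mid /hi_coker /lo_mid /=.
have [/andP[lm mr] _ _] := apexP w; have lw := arc_lt arcs w; have lw' := arc_lt arcs w'.
case: (a =P b) => [->|]; last by rewrite mul0r eqxx.
have [->|neq] := eqVneq w' w.
  move=> _; rewrite leqnn /=; case: (boolP (inside b w)) => //= aw; case: ifP => // _.
  by rewrite /support_end; lia.
case: and3P => [[bw' bw cw]|]; last by rewrite subrr mulr0 eqxx.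
move=> _; rewrite bw bw' /= /support_end; move: bw bw' cw; rewrite !insideE /is_child.
case: ifP; lia.
Qed.

Definition coker_map : {linear M lo_mid hi_mid -> M lo_mid hi_coker} :=
  matrix_map cA coker_matrix_hom.

Lemma get_coker_map t a w l : in_interval lo_mid hi_coker (a, w) l ->
  get (coker_map t) (a, w) l = get t (a, w) l -
    \sum_(u | inside a u && is_child w u) get t (a, u) l.
Proof.
move=> il; rewrite matrix_mapE get_matrix_fun il; move: il.
rewrite in_coker => /and3P[aw lw _].
rewrite (eq_bigr (fun p : 'I_n * V =>
  coker_matrix (p.1, p.2) (a, w) * get t (p.1, p.2) l)); last by case.
rewrite -(pair_bigA _ (fun b u =>
  coker_matrix (b, u) (a, w) * get t (b, u) l)) /=.
rewrite (bigD1 a) //= [X in _ + X]big1 ?addr0 => [|b ba]; last first.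
  by rewrite big1 // => u _; rewrite /coker_matrix /= (negPf ba) !mul0r.
rewrite (eq_bigr (fun u => (u == w)%:R * get t (a, u) l -
    (if inside a u && is_child w u then get t (a, u) l else 0))) => [|u _]; last first.
  rewrite /coker_matrix /= eqxx mul1r mulrBl aw /=; congr (_ - _).
  by case: ifP; rewrite ?mul1r ?mul0r.
rewrite sumrB -big_mkcond; congr (_ - _).
rewrite (bigD1 w) //= eqxx mul1r big1 ?addr0 // => u uw.
by rewrite (negPf uw) mul0r.
Qed.

(** The row a of x, repeated in each M(w) with w around a. *)
Definition mid_fun (x : (A^c)^o) : M lo_mid hi_mid :=
  mk cA lo_mid hi_mid (fun p l => cA x p.1 l).

Lemma get_mid_fun x a w l : get (mid_fun x) (a, w) l =
  if inside a w && inside l w then cA x a l else 0.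
Proof. by rewrite get_mk in_mid. Qed.

Lemma mid_fun_linear : linear mid_fun.
Proof.
move=> b x y; apply: get_ext => -[a w] l il.
rewrite getD getZ !get_mid_fun il; move: il; rewrite in_mid => /[dup] il -> /=.
case/andP: il => aw lw; rewrite [LHS](coordD cA); congr (_ + _).
have [al|nal] := boolP (ord_le a l); last first.
  rewrite (coord_out cA) // big1 // => c _; rewrite get_mid_fun.
  case: ifP => _; last by rewrite mul0r.
  have [->|/coord_neq0 ac] := eqVneq (cA x a c) 0; first by rewrite mul0r.
  rewrite [cA b c l](coord_out cA) ?mulr0 //.
  by move: nal ac; rewrite /ord_le; lia.
rewrite [LHS](coordM cA) //; apply: eq_bigr => c _; rewrite get_mid_fun aw /=.
case: ifPn => // ncw.
have [->|/coord_neq0 ac] := eqVneq (cA x a c) 0; first by rewrite mul0r.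
rewrite mul0r [cA b c l](coord_out cA) ?mulr0 //.
by move: aw lw ncw ac; rewrite !insideE /ord_le; lia.
Qed.

Definition mid_map : {linear (A^c)^o -> M lo_mid hi_mid} := linear_map mid_fun_linear.

Lemma root_inside v0 a : lft v0 = 0%N -> rgt v0 = n.+1 -> inside a v0.
Proof. by move=> E1 E2; rewrite insideE E1 E2 /= !ltnS ltn_ord. Qed.

Lemma mid_map_inj : injective mid_map.
Proof.
move=> x y xy; have [v0 E1 E2] := arc_root arcs.
apply: (coord_ext (cA := cA)) => a l al.
have := congr1 (fun t => get t (a, v0) l) xy.
by rewrite !linear_mapE !get_mid_fun !root_inside.
Qed.

Lemma coker_mid x : coker_map (mid_map x) = 0.
Proof.
apply: get_ext => -[a w] l il; rewrite get_coker_map // get0.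
move: il; rewrite in_coker => /and3P[aw lw ml].
under eq_bigr => u /andP[au _] do rewrite linear_mapE get_mid_fun au /=.
rewrite linear_mapE get_mid_fun aw lw /=.
have [al|nal] := boolP (ord_le a l); last first.
  rewrite (coord_out cA) // big1 ?subrr // => u _.
  by case: ifP.
rewrite /ord_le in al; have Ea : a.+1 <> apex w by move: ml; lia.
have [u [au uw uniq]] := child_exists aw Ea.
rewrite (big_pred1 u) //.
rewrite ifT ?subrr //.
have [/andP[lm mr] _ _] := apexP w.
move: au uw aw lw ml; rewrite !insideE /is_child; lia.
Qed.


Section Kernel.
Variable t : M lo_mid hi_mid.
Hypothesis ker_t : coker_map t = 0.

(** In the kernel, components of successive arcs around a agree at the vertices
    where N(a, w) is supported. *)
Lemma ker_step (a : 'I_n) w l : in_interval lo_mid hi_coker (a, w) l ->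
  a.+1 <> apex w -> exists u, [/\ inside a u, is_child w u &
    get t (a, w) l = get t (a, u) l].
Proof.
move=> il am; have : inside a w by move: il; rewrite in_coker => /and3P[].
move=> /child_exists/(_ am)[u [au uw uniq]]; exists u; split=> //.
have /eqP := congr1 (fun y => get y (a, w) l) ker_t.
rewrite get_coker_map // get0 subr_eq0 => /eqP ->.
by rewrite (big_pred1 u).
Qed.

(** To the left of a, N(a, w) is supported wherever M(w) is, so the component can
    be followed down the chain until it leaves the support, or reaches the arc
    with apex a, where N(a, w) compares M(w) with zero. *)
Lemma ker_before (a : 'I_n) w (l : 'I_n) : (l < a)%N -> get t (a, w) l = 0.
Proof.
move=> la; have [m] := ubnP (rgt w - lft w); elim: m w => // m IHm w le_m.
have [awlw|nil] := boolP (inside a w && inside l w); last first.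
  by rewrite get_out // in_mid.
case/andP: awlw => aw lw.
have il : in_interval lo_mid hi_coker (a, w) l by rewrite in_coker aw lw; lia.
have [am|am] := eqVneq a.+1 (apex w); last first.
  have [u [au uw ->]] := ker_step il (elimN eqP am); apply: IHm.
  have [/andP[lm mr] _ _] := apexP w.
  have [/andP[? ?] neq] := is_child_sub uw; move: uw; rewrite /is_child; lia.
have /eqP := congr1 (fun y => get y (a, w) l) ker_t.
rewrite get_coker_map // get0 big_pred0 ?subr0 => [/eqP //|u].
by have [/(child_none am)/negPf->|//] := boolP (inside a u).
Qed.

(** From a on, the component can be followed down the chain until the apex
    separates a from l; by [apex_between_uniq] this arc depends on a and l only. *)
Lemma ker_after (a : 'I_n) w (l : 'I_n) : (a <= l)%N -> inside a w -> inside l w ->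
  exists w', [/\ inside a w', inside l w', (a < apex w' <= l.+1)%N &
    get t (a, w) l = get t (a, w') l].
Proof.
move=> al; have [m] := ubnP (rgt w - lft w); elim: m w => // m IHm w le_m aw lw.
have [aml|naml] := boolP (a < apex w <= l.+1)%N; first by exists w.
have il : in_interval lo_mid hi_coker (a, w) l by rewrite in_coker aw lw; lia.
have [|u [au uw ->]] := ker_step il; first by lia.
have [/andP[lm mr] _ _] := apexP w.
have lu : inside l u.
  by move: naml au uw aw lw; rewrite !insideE /is_child; lia.
apply: IHm => //; move: uw; rewrite /is_child; lia.
Qed.

Lemma apex_between_uniq (a l : 'I_n) u v : inside a u -> inside l u ->
  inside a v -> inside l v -> (a < apex u <= l.+1)%N -> (a < apex v <= l.+1)%N ->
  u = v.
Proof.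
wlog uv : u v / sub_arc u v => [W au lu av lv mu mv|].
  have [uv|vu] := orP (sub_arc_total au av); first exact: W.
  by apply/esym/W.
move=> au lu av lv mu mv; have [//|H|H] := sub_arc_apex uv;
  move: au lu mv H; rewrite !insideE; lia.
Qed.

Lemma ker_mid : exists x, mid_map x = t.
Proof.
have [v0 E1 E2] := arc_root arcs.
exists (elt_of cA (fun a l => get t (a, v0) l)).
apply: get_ext => -[a w] l; rewrite linear_mapE get_mid_fun => il.
move: (il); rewrite in_mid => /[dup] awlw -> /=; case/andP: awlw => aw lw.
rewrite coord_elt /ord_le; case: leqP => [al|la]; last by rewrite ker_before.
have [w1 [a1 l1 m1 ->]] := ker_after al (root_inside a E1 E2) (root_inside l E1 E2).
have [w2 [a2 l2 m2 ->]] := ker_after al aw lw.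
by rewrite (apex_between_uniq a1 l1 a2 l2).
Qed.

End Kernel.

(** The equations t(w) - t(next smaller arc) = y(w) are solved by summing y down
    the chain of arcs around a. *)
Lemma coker_map_surj : surj coker_map.
Proof.
move=> y.
exists (mk cA lo_mid hi_mid (fun p l =>
  \sum_(w | inside p.1 w && sub_arc w p.2) get y (p.1, w) l)).
apply: get_ext => -[a w] l il; rewrite get_coker_map // get_mk in_mid /=.
have /and3P[aw lw ml] : [&& inside a w, inside l w & (a < apex w)%N ==> (l.+1 < apex w)%N].
  by rewrite -in_coker.
have ww : sub_arc w w by rewrite /sub_arc !leqnn.
rewrite aw lw /= (bigD1 w) ?aw //= -[RHS]addr0 -addrA; congr (_ + _).
apply/eqP; rewrite subr_eq0; apply/eqP.
have [am|/eqP am] := eqVneq a.+1 (apex w).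
  rewrite big_pred0 => [|u]; last first.
    apply/negP => /andP[/andP[au /sub_arc_apex uw] /eqP neq].
    by case: uw => // H; move: au; rewrite insideE am; lia.
  by rewrite big_pred0 // => u; apply/negP => /andP[/(child_none am)/negPf->].
have [u [au uw uniq]] := child_exists aw am.
rewrite [RHS](big_pred1 u) //.
rewrite get_mk in_mid au /=.
rewrite (eq_bigl (fun w' => inside a w' && sub_arc w' u)) => [|w']; last first.
  rewrite -andbA; have [aw'|//] := boolP (inside a w').
  by rewrite -(sub_child au uw aw').
case: ifPn => // nlu; apply: big1 => w' /andP[aw' /andP[H1 H2]].
by rewrite get_out // in_coker; move: nlu; rewrite !insideE; lia.
Qed.

Theorem arc_module_tilting : tilting_module T.
Proof.
have [v0 _ _] := arc_root arcs.
have lo_hi v : (lft v <= support_end v <= n)%N.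
  by rewrite /support_end; have := arc_lt arcs v; have := arc_bound arcs v; lia.
split.
- exact: intmod_fin_gen.
- exact: intmod_pdim_le1.
- apply: intmod_ext1 => // u v; rewrite /support_end.
  have := arc_nc arcs (u := u) (v := v); have := arc_lt arcs u.
  by have := arc_lt arcs v; lia.
exists (M lo_mid hi_mid), (M lo_mid hi_coker), mid_map, coker_map; split.
- apply: intmod_in_add => // -[a w]; rewrite /hi_mid /lo_mid /=.
  by case: ifP => _; [right; exists w | left].
- apply: intmod_in_add => // -[a w]; rewrite /hi_coker /lo_mid /=.
  case: ifP => _; first by left.
  case: ifP => _; last by right; exists w.
  have [_ /segmentP sl _] := apexP w.
  by case: sl => [->|[x <- <-]]; [left | right; exists x].
split; [exact: mid_map_inj | exact: coker_map_surj | move=> t; split].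
  exact: ker_mid.
by case=> x <-; apply: coker_mid.
Qed.

End Coresolution.

(** * The endomorphism algebra of the tilting module *)

Section Endomorphisms.
Variables (n : nat) (V : finType) (lft rgt : V -> nat).
Hypothesis arcs : arc_system n lft rgt.
Variables (k : comNzRingType) (A B : algType k).
Variables (cA : coordinates A (@ord_le n)) (cB : coordinates B (arc_rel lft rgt)).
Local Notation T := (intmod lft (support_end rgt) cA).

(** The (u, v) coordinate of x is a scalar on the component M(v) -> M(u). *)
Lemma coord_transpose_hom (x : B) :
  hom_matrix lft (support_end rgt) lft (support_end rgt) (fun v u => cB x u v).
Proof.
move=> v u /coord_neq0/and3P[uv_l uv_r _].
by rewrite uv_l /support_end; lia.
Qed.

Definition end_map (x : B) : {linear T -> T} := matrix_map cA (@coord_transpose_hom x).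

Lemma get_end_map x t u l : get (end_map x t) u l =
  if in_interval lft (support_end rgt) u l then \sum_v cB x u v * get t v l else 0.
Proof. by rewrite matrix_mapE get_matrix_fun. Qed.

(** If M(u) and M(w) overlap and both end points increase from u to w, then u and
    w share an end point, since they do not cross.  So the entries discarded in
    the product of coordinates are those that act as zero on T, and a
    matrix of maps between the M(v) has no entries outside [arc_rel]. *)
Lemma end_map_iso : is_end_iso end_map.
Proof.
split.
- move=> x y t; apply: get_ext => u l ul; rewrite /= getD !get_end_map ul.
  by rewrite -big_split; apply: eq_bigr => v _; rewrite coordD mulrDl.
- move=> c x t; apply: get_ext => u l ul; rewrite get_scalar !get_end_map ul.
  by rewrite mulr_sumr; apply: eq_bigr => v _; rewrite coordZ mulrA.
- move=> t; apply: get_ext => u l ul; rewrite get_end_map ul.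
  rewrite (bigD1 u) //= coord1 eqxx mul1r big1 ?addr0 // => v vu.
  by rewrite coord1 eq_sym (negPf vu) mul0r.
- move=> x y t; apply: get_ext => u l ul; rewrite /= !get_end_map ul.
  transitivity (\sum_w \sum_v cB x u v * cB y v w * get t w l).
    apply: eq_bigr => w _; rewrite -mulr_suml.
    have [->|/get_neq0 wl] := eqVneq (get t w l) 0; first by rewrite !mulr0.
    have [uw|nuw] := boolP (arc_rel lft rgt u w); first by rewrite (coordM cB).
    rewrite (coord_out cB) // big1 ?mul0r // => v _.
    have [->|/coord_neq0 uv] := eqVneq (cB x u v) 0; first by rewrite mul0r.
    have [->|/coord_neq0 vw] := eqVneq (cB y v w) 0; first by rewrite mulr0.
    move: ul wl uv vw nuw; rewrite -!/(inside lft rgt _ _) !(insideE arcs) /arc_rel.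
    have := arc_nc arcs (u := u) (v := w).
    by have := arc_nc arcs (u := w) (v := u); lia.
  rewrite exchange_big; apply: eq_bigr => v _ /=; rewrite get_end_map.
  case: ifPn => [vl|nvl]; first by rewrite mulr_sumr; apply: eq_bigr => w _; rewrite mulrA.
  rewrite mulr0 big1 // => w _.
  have [->|/get_neq0 wl] := eqVneq (get t w l) 0; first by rewrite mulr0.
  have [->|/coord_neq0 uv] := eqVneq (cB x u v) 0; first by rewrite !mul0r.
  have [->|/coord_neq0 vw] := eqVneq (cB y v w) 0; first by rewrite mulr0 mul0r.
  move: ul wl uv vw nvl; rewrite -!/(inside lft rgt _ _) !(insideE arcs) /arc_rel; lia.
move=> f; have [|C CP fE] := @matrix_mapP _ _ _ cA _ _ _ _ _ _ f.
  by move=> v; rewrite /support_end; have := arc_bound arcs v; lia.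
have CE t u l : in_interval lft (support_end rgt) u l ->
    get (f t) u l = \sum_v C v u * get t v l.
  by move=> ul; rewrite fE get_matrix_fun ifT.
exists (elt_of cB (fun u v => C v u)) => [t|y yf].
  apply: get_ext => u l ul; rewrite get_end_map ul CE //.
  apply: eq_bigr => v _; rewrite coord_elt; case: ifPn => // nuv.
  have [->|Cvu] := eqVneq (C v u) 0; first by [].
  case/and3P: (CP v u Cvu) => [H1 H2 H3]; move: nuv H1 H2 H3.
  rewrite /arc_rel /support_end; have := arc_lt arcs v.
  have := arc_nc arcs (u := u) (v := v); have := arc_lt arcs u; lia.
apply: (coord_ext (cA := cB)) => u v uv; rewrite coord_elt uv.
have := arc_lt arcs u; have := arc_lt arcs v; have := arc_bound arcs u => ub lv lu.
have lft_n : (lft v < n)%N by move: (arc_bound arcs v); lia.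
pose l := Ordinal lft_n.
have ul : in_interval lft (support_end rgt) u l.
  rewrite -/(inside lft rgt l u) (insideE arcs) /=; move: uv; rewrite /arc_rel.
  have := arc_nc arcs (u := u) (v := v); lia.
have vl : in_interval lft (support_end rgt) v l.
  by rewrite -/(inside lft rgt l v) (insideE arcs) /=; lia.
(* constant on the summand M(v), so that its value at l is the value of its
   generator, transported to l *)
pose t : T := mk cA lft (support_end rgt) (fun w _ => (w == v)%:R).
have sumt (F : V -> k) : \sum_w F w * get t w l = F v.
  rewrite (bigD1 v) //= get_mk ifT // eqxx mulr1 big1 ?addr0 // => w wv.
  by rewrite get_mk (negPf wv) if_same mulr0.
by have := congr1 (fun z => get z u l) (yf t); rewrite get_end_map ul CE // !sumt.
Qed.

Lemma arc_tilted : tilted_of A B.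
Proof.
by exists T; split; [exact: arc_module_tilting | exists end_map; exact: end_map_iso].
Qed.

End Endomorphisms.

(** * Hereditary and non-hereditary algebras *)

(** Coordinates over a partial order whose intervals are chains. *)
Section Hereditary.
Variables (k : fieldType) (B : algType k) (V : finType) (r : rel V).
Variable cB : coordinates B r.
Hypothesis r_trans : transitive r.
Hypothesis r_anti : antisymmetric r.
Hypothesis r_chain : forall u v v' w,
  r u v -> r v w -> r u v' -> r v' w -> r v v' || r v' v.

Section Ideal.
Variables (J : lmodType B^c) (i : {linear J -> (B^c)^o}).
Hypothesis inj_i : injective i.

Definition image_support (q : {linear J -> J}) : {set V * V} :=
  [set p : V * V | `[< exists y, cB (i (q y)) p.1 p.2 != 0 >]].

Lemma image_supportP (q : {linear J -> J}) u v :
  reflect (exists y, cB (i (q y)) u v != 0) ((u, v) \in image_support q).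
Proof. by rewrite inE; apply: asboolP. Qed.

(** A dual basis of the image of q, by induction on its support.  Choose (u, v) in
    the support with v minimal, and x = x e_v in the image with c = x(u, v)
    non-zero.  The row u of an element of the image, restricted to the columns
    above v and moved to the row v, depends linearly on the element: a column z
    of the row u that is not above v contributes only to columns above z, and if
    one of these is above v then z is comparable to v, hence strictly below v,
    where the row vanishes.  Subtracting from q y the multiple of x with the same
    entry at (u, v) removes (u, v) from the support. *)
Lemma linear_dual_basis (q : {linear J -> J}) :
  exists s : seq (J * {linear J -> (B^c)^o}),
    forall y, q y = \sum_(p <- s) (p.2 y : B^c) *: p.1.
Proof.
have [m] := ubnP #|image_support q|; elim: m q => // m IHm q le_m.
have [E0|[p0 p0q]] := set_0Vmem (image_support q).
  exists [::] => y; rewrite big_nil; apply: inj_i; rewrite linear0.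
  apply: (coord_eq0 (c := cB)) => u v _; apply/eqP; apply: contraT => H.
  suff : (u, v) \in image_support q by rewrite E0 inE.
  by apply/image_supportP; exists y.
(* counting predecessors turns a minimal column into a minimum *)
pose f (p : V * V) := #|[set z | r z p.2]|.
case: (arg_minnP f p0q) => -[u v] uvq min_uv.
have minv v' y : r v' v -> v' != v -> cB (i (q y)) u v' = 0.
  move=> v'v neq; apply/eqP; apply: contraT => H.
  have /min_uv : (u, v') \in image_support q by apply/image_supportP; exists y.
  rewrite leqNgt /f => /negP; case; apply: proper_card; apply/properP; split.
    by apply/subsetP => z; rewrite !inE => /r_trans; apply.
  exists v; rewrite !inE ?(coordinates_refl cB) //.
  by apply: contra neq => vv'; apply/eqP/r_anti; rewrite v'v.
case/image_supportP: (uvq) => y0 c_neq0; set c := cB _ u v in c_neq0.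
have r_uv : r u v := coord_neq0 c_neq0.
(* the idempotent of v *)
pose ev : B := elt_of cB (fun a b => ((a == v) && (b == v))%:R).
pose x0 : J := (ev : B^c) *: y0; pose x := q x0.
have xE a b : cB (i x) a b = if b == v then cB (i (q y0)) a v else 0.
  have -> : i x = (i (q y0) : B) * ev by rewrite /x linearZ linearZ.
  have [ab|nab] := boolP (r a b); last first.
    rewrite (coord_out cB) //; case: eqP nab => // -> nav.
    by rewrite (coord_out cB).
  rewrite (coordM cB) // (bigD1 v) //= big1 ?addr0 => [|z zv].
    rewrite coord_elt eqxx /=; case: eqP => [->|_]; last by case: ifP; rewrite mulr0.
    by rewrite (coordinates_refl cB) mulr1.
  by rewrite coord_elt (negPf zv) /=; case: ifP; rewrite mulr0.
pose pi y : (B^c)^o := elt_of cB (fun a b => (a == v)%:R * (cB (i (q y)) u b / c)).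
have piE y a b : cB (pi y) a b =
    if r a b then (a == v)%:R * (cB (i (q y)) u b / c) else 0.
  exact: coord_elt.
have lin_pi : linear pi.
  move=> a y y'; apply: (coord_ext (cA := cB)) => s t st.
  rewrite [RHS](coordD cB) !piE st !linearP [cB (_ + _) u t](coordD cB).
  rewrite mulrDl mulrDr; congr (_ + _).
  rewrite [RHS](coordM cB) //; under [RHS]eq_bigr => z _ do rewrite piE.
  have [Es|_] := eqVneq s v; last first.
    by rewrite mul0r big1 // => z _; rewrite mul0r; case: ifP; rewrite mul0r.
  subst s; rewrite mul1r [cB _ u t](coordM cB); last exact: r_trans st.
  rewrite mulr_suml; apply: eq_bigr => z _; rewrite mul1r.
  case: ifPn => [_|nvz]; first by rewrite mulrAC.
  have [->|Hz] := eqVneq (cB (i (q y)) u z) 0; first by rewrite !mul0r.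
  have [->|/coord_neq0 zt] := eqVneq (cB a z t) 0; first by rewrite mulr0 !mul0r.
  have uz := coord_neq0 Hz.
  have := r_chain r_uv st uz zt; rewrite (negPf nvz) /= => zv.
  by rewrite minv ?eqxx // in Hz; apply: contraNneq nvz => ->; rewrite (coordinates_refl cB).
pose q' y := q y - (pi y : B^c) *: x.
have lin_q' : linear q'.
  move=> a y y'; rewrite /q' linearP [pi _]lin_pi scalerDl scalerBr scalerA.
  by rewrite opprD addrACA.
have q'E y : q' y = q (y - (pi y : B^c) *: x0).
  by rewrite [RHS]linearB [X in _ = _ - X]linearZ.
have [|s sE] := IHm (linear_map lin_q').
  move: le_m; rewrite ltnS; apply: leq_trans; apply: proper_card; apply/properP; split.
    apply/subsetP => -[a b] /image_supportP[y]; rewrite linear_mapE q'E => H.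
    by apply/image_supportP; exists (y - (pi y : B^c) *: x0).
  exists (u, v) => //; apply/image_supportP => -[y]; rewrite linear_mapE /q' linearB linearZ.
  rewrite [cB _ u v](coordB cB) [X in _ - X](coordM cB) // (bigD1 v) //= big1 => [|z zv].
    rewrite addr0 xE eqxx piE (coordinates_refl cB) eqxx mul1r -/c mulrC.
    by rewrite divfK // subrr eqxx.
  by rewrite xE (negPf zv) mul0r.
exists ((x, linear_map lin_pi) :: s) => y.
by rewrite big_cons -sE !linear_mapE /q' addrC subrK.
Qed.

End Ideal.

Lemma chain_hereditary : hereditary B.
Proof.
move=> J i inj_i.
have [s sE] := linear_dual_basis inj_i (linear_map (f := id) (fun a x y => erefl)).
by apply: (@projective_dual_basis _ _ s).
Qed.

End Hereditary.

Section NonHereditary.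
Variables (k : fieldType) (B : algType k) (V : finType) (r : rel V).
Variable cB : coordinates B r.

(** Let al and be be the basis elements (u, v) and (v, w), whose product is 0.  A
    section of b |-> al b on al B sends al to some b with al b = al and b be = 0,
    so that b(v, v) = 1 and b(v, v) = 0. *)
Lemma zero_product_not_hereditary u v w :
    r u v -> r v w -> ~~ r u w ->
  ~ hereditary B.
Proof.
move=> uv vw nuw hered.
pose unit_elt a b : B := elt_of cB (fun x y => ((x == a) && (y == b))%:R).
have unitE a b x y : r a b -> cB (unit_elt a b) x y = ((x == a) && (y == b))%:R.
  move=> ab; rewrite coord_elt; case: ifPn => // nxy.
  by case: andP => // -[/eqP Ea /eqP Eb]; rewrite Ea Eb ab in nxy.
pose al := unit_elt u v; pose be := unit_elt v w.
have albe : al * be = 0.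
  apply: (coord_eq0 (c := cB)) => x y xy; rewrite (coordM cB) // big1 // => z _.
  rewrite !unitE //; case: eqP => [Ex|]; last by rewrite mul0r.
  case: (y =P w) => [Ey|]; last by rewrite andbF mulr0.
  by rewrite Ex Ey (negPf nuw) in xy.
pose S (x : (B^c)^o) := exists b : B, x = al * b.
have SP (a : B^c) x y : S x -> S y -> S (a *: x + y).
  move=> [b ->] [b' ->]; exists (b * a + b').
  by rewrite mulrDr mulrA.
have S0 : S 0 by exists 0; rewrite mulr0.
pose J := submodule SP S0.
have Sal (b : B) : ((al * b : B) : (B^c)^o) \in sub_pred SP S0.
  by apply/asboolP; exists b.
have projJ := hered J val val_inj.
pose g (b : (B^c)^o) : J :=
  exist (fun x : (B^c)^o => x \in sub_pred SP S0) (al * (b : B)) (Sal b).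
have lin_g : linear g.
  by move=> a b b'; apply: val_inj; rewrite /= mulrDr mulrA.
have surj_g : surj (linear_map lin_g).
  move=> [x xS]; have [b xE] := asboolP _ xS; exists b; apply: val_inj.
  by rewrite linear_mapE /= xE.
have [h hE] := projJ _ _ (linear_map lin_g)
  (linear_map (f := id) (fun a x y => erefl)) surj_g.
pose x := g (1 : B); pose b : B := h x.
have al_b : al * b = al.
  have E : val (g (h x)) = val x := congr1 val (hE x).
  by rewrite /= mulr1 in E.
have b_be : b * be = 0.
  have : (be : B^c) *: h x = h ((be : B^c) *: x) by rewrite linearZ.
  have -> : (be : B^c) *: x = 0.
    by apply: val_inj; rewrite /= -[RHS]albe mulr1.
  by rewrite linear0.
have bv : cB b v v = 1.
  have := congr1 (fun z => cB z u v) al_b; rewrite (coordM cB) // (bigD1 v) //=.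
  rewrite big1 ?addr0 => [|z zv]; rewrite unitE // ?eqxx ?mul1r //.
  by rewrite (negPf zv) andbF mul0r.
have := congr1 (fun z => cB z v w) b_be; rewrite (coordM cB) // coord0 (bigD1 v) //=.
rewrite big1 ?addr0 => [|z zv]; rewrite unitE //.
  by rewrite !eqxx bv mul1r => /eqP; rewrite oner_eq0.
by rewrite (negPf zv) mulr0.
Qed.

End NonHereditary.

Section ArcHereditary.
Variables (n : nat) (V : finType) (lft rgt : V -> nat).
Hypothesis arcs : arc_system n lft rgt.
Variables (k : fieldType) (B : algType k) (cB : coordinates B (arc_rel lft rgt)).

(** Composing u -> v and v -> w gives a path; if its ends are not related it
    turns inside a triangle, and all sides of this triangle are arcs. *)
Lemma arc_rel_trans :
  ~ (exists u v w, [/\ lft u = lft v, rgt u = lft w & rgt v = rgt w]) ->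
  transitive (arc_rel lft rgt).
Proof.
move=> no_tri v u w uv vw; apply: contra_notT no_tri => nuw.
pose e u v := left_arrow lft rgt u v || right_arrow lft rgt u v.
have [s ps Es] := arc_path arcs (e := e) (fun u v => erefl) uv.
have [t pt Et] := arc_path arcs (e := e) (fun u v => erefl) vw.
have := arc_path_split arcs (e := e) (fun u v => erefl) (u := u) (s := s ++ t).
rewrite cat_path last_cat Es ps Et => /(_ pt nuw)[s1 [y [z [s2 [_ xy yz]]]]].
have E := left_right_arrow arcs xy yz; exists (last u s1), y, z.
by case/and3P: xy => /eqP ? _ _; case/and3P: yz => /eqP ? _ _.
Qed.

Lemma arc_hereditary :
  ~ (exists u v w, [/\ lft u = lft v, rgt u = lft w & rgt v = rgt w]) ->
  hereditary B.
Proof.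
move=> /arc_rel_trans tr; apply: (chain_hereditary cB) => //.
- move=> u v /andP[/and3P[? ? _] /and3P[? ? _]]; apply: (arc_inj arcs); lia.
- move=> u v v' w uv vw uv' v'w; have := tr _ _ _ uv vw.
  move: uv vw uv' v'w; rewrite /arc_rel; lia.
Qed.

Lemma arc_not_hereditary :
  (exists u v w, [/\ lft u = lft v, rgt u = lft w & rgt v = rgt w]) ->
  ~ hereditary B.
Proof.
case=> u [v [w [E1 E2 E3]]].
have := arc_lt arcs u; have := arc_lt arcs v; have := arc_lt arcs w => lw lv lu.
by apply: (zero_product_not_hereditary cB (u := u) (v := v) (w := w));
  rewrite /arc_rel; lia.
Qed.

End ArcHereditary.

(** * Curves and triangles in the disk *)

Section Disk.
Variable n : nat.
Local Notation pt := 'I_n.+3.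
Implicit Types (a b q : pt) (c d : curve n).

Lemma set2_lt_inj a b a' b' : (a < b)%N -> (a' < b')%N ->
  [set a; b] = [set a'; b'] -> a = a' /\ b = b'.
Proof.
move=> ab ab' E.
have : a \in [set a'; b'] by rewrite -E set21.
have : b \in [set a'; b'] by rewrite -E set22.
have : a' \in [set a; b] by rewrite E set21.
have : b' \in [set a; b] by rewrite E set22.
rewrite !in_set2 => /orP[]/eqP E1 /orP[]/eqP E2 /orP[]/eqP E3 /orP[]/eqP E4;
  subst; split=> //; apply: val_inj => /=; lia.
Qed.

Lemma interleavedE a b a' b' : (a < b)%N -> (a' < b')%N ->
  interleaved [set a; b] [set a'; b'] = (a < a' < b)%N && (b < b')%N.
Proof.
move=> ab ab'; apply/existsP/idP => [[x /existsP[x' /existsP[y /existsP[y']]]]|].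
  case/and5P=> H1 H2 H3 /eqP E1 /eqP E2.
  have [|? ?] := set2_lt_inj ab _ E1; first by lia.
  have [|? ?] := set2_lt_inj ab' _ E2; first by lia.
  by subst; rewrite H1 H2 H3.
case/andP=> /andP[H1 H2] H3; exists a; apply/existsP; exists a'; apply/existsP; exists b.
by apply/existsP; exists b'; rewrite H1 H2 H3 !eqxx.
Qed.

Lemma interleaved_is_curve c d : interleaved c d -> (#|c| == 2) && (#|d| == 2).
Proof.
case/existsP=> x /existsP[x' /existsP[y /existsP[y' /and5P[H1 H2 H3 /eqP-> /eqP->]]]].
by rewrite !cards2 -!val_eqE /=; lia.
Qed.

Lemma curve_ends c : is_curve c -> exists a b, (a < b)%N /\ c = [set a; b].
Proof.
rewrite /is_curve => /cards2P[x [y [neq ->]]]; case: (ltngtP x y) => [xy|yx|/val_inj E].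
- by exists x, y.
- by exists y, x; rewrite setUC.
- by rewrite E eqxx in neq.
Qed.

(** The second alternative is the segment from x_(n+1) back to p. *)
Lemma boundary_segmentE a b : (a < b)%N ->
  boundary_segment [set a; b] = (b == a.+1 :> nat) || (a == 0 :> nat) && (b == n.+2 :> nat).
Proof.
move=> ab; have vS (x : pt) : ordS x = (if x == n.+2 :> nat then 0%N else x.+1) :> nat.
  rewrite /=; case: eqP => [->|neq]; first by rewrite modnn.
  by rewrite modn_small // ltnS; have := ltn_ord x; lia.
have lb := ltn_ord b.
apply/existsP/idP => [[x /eqP]|].
  move: (ordS x) (vS x) => y; case: eqP => [Ex Sy|neq Sy] E.
    rewrite [RHS]setUC in E; have [|? ?] := set2_lt_inj ab _ E; first by lia.
    by subst; lia.
  by have [|? ?] := set2_lt_inj ab _ E; [lia | subst; lia].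
case/orP=> [/eqP E|/andP[/eqP E1 /eqP E2]].
  exists a; apply/eqP; congr [set _; _]; apply: val_inj; apply: etrans E _.
  apply/esym; rewrite [LHS]vS ifF //.
  by apply/negbTE/eqP; lia.
exists b; rewrite setUC; apply/eqP; congr [set _; _]; apply: val_inj.
by apply: etrans E1 _; apply/esym; rewrite [LHS]vS E2 eqxx.
Qed.

Lemma pt_xE (i : 'I_n.+2) : pt_x i = i.+1 :> nat.
Proof. exact: lift0. Qed.

(** A curve through p crosses no p x_i; a curve x_i x_j crosses p x_l exactly
    when l is strictly between i and j. *)
Lemma nontrivialE a b : nontrivial [set a; b] =
  [&& 0 < a, 0 < b & (a.+1 < b) || (b.+1 < a)]%N.
Proof.
wlog ab : a b / (a <= b)%N.
  by move=> W; case: (leqP a b) => [/W //|/ltnW/W]; rewrite setUC => ->; lia.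
apply/existsP/idP => [[d /andP[/imsetP[i _ ->]]]|].
  have p_lt : (pt_p n < pt_x i)%N by rewrite pt_xE.
  move=> cr; have {}ab : (a < b)%N.
    rewrite ltn_neqAle ab andbT; apply: contraTN cr => /eqP/val_inj ->.
    apply/negP => /orP[]/interleaved_is_curve; rewrite setUid !cards1 ?andbF //.
  move: cr; rewrite /cross !interleavedE // pt_xE /=; lia.
case/and3P=> a0 b0 /orP[aSb|]; last by lia.
have ab' : (a < b)%N by lia.
have lb := ltn_ord b.
(* the point following a, i.e. x_a *)
pose i : 'I_n.+2 := inord a.
have iE : i = a :> nat by rewrite /i inordK //; lia.
have p_lt : (pt_p n < pt_x i)%N by rewrite pt_xE.
exists [set pt_p n; pt_x i]; apply/andP; split.
  by apply/imsetP; exists i => //; rewrite inE iE; lia.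
by rewrite /cross !interleavedE // pt_xE /= iE; lia.
Qed.

Lemma iter_ord_pred m b : (m <= b)%N -> iter m (@ord_pred _) b = (b - m)%N :> nat.
Proof.
elim: m => [|m IHm] mb; first by rewrite subn0.
rewrite iterS /= IHm; last exact: ltnW.
have lb := ltn_ord b.
have -> : ((b - m + n.+3).-1 = (b - m.+1) + n.+3)%N by lia.
by rewrite modnDr modn_small //; lia.
Qed.

(** The moving end stays away from p and from q, as all curves through p are
    trivial and a curve has two distinct ends; so it remains on the same side of q. *)
Lemma clockwise_move_ends q b c : (0 < q)%N -> (0 < b)%N -> q != b ->
  clockwise_move q [set q; b] c -> c != [set q; b] ->
  exists2 b' : pt, c = [set q; b'] & (0 < b' < b)%N && ((q < b') || (b < q))%N.
Proof.
move=> q0 b0 qb /existsP[b1 /existsP[m /and3P[/eqP Eb /eqP -> /forallP nt]]] neq.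
have Eb1 : b1 = b.
  have : b \in [set q; b1] by rewrite -Eb set22.
  by rewrite in_set2 eq_sym (negPf qb) => /eqP.
subst b1; have ntl l : (0 < l <= m)%N -> nontrivial [set q; iter l (@ord_pred _) b].
  move=> lm; have l_lt : (l < n.+3)%N by apply: leq_ltn_trans (ltn_ord m); case/andP: lm.
  by have := implyP (nt (Ordinal l_lt)); apply.
have mb : (m < b)%N.
  rewrite ltnNge; apply/negP => bm; have := ntl b; rewrite b0 bm => /(_ isT).
  by rewrite nontrivialE iter_ord_pred // subnn; lia.
have m0 : (0 < m)%N.
  by rewrite lt0n; apply: contraNneq neq => ->.
have := iter_ord_pred (ltnW mb); set b' := iter m _ b => b'E; exists b' => //.
have {}qb : q <> b :> nat by move/val_inj/eqP; apply/negP.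
case: (ltnP b q) => [_|bq]; first by lia.
case: (ltnP q b') => [_|b'q]; first by lia.
have := ntl (b - q)%N; rewrite nontrivialE iter_ord_pred; lia.
Qed.

Lemma clockwise_move_intro q b b' : (0 < q)%N -> (0 < b')%N -> (b' < b)%N ->
  (q.+1 < b')%N || (b.+1 < q)%N -> clockwise_move q [set q; b] [set q; b'].
Proof.
move=> q0 b'0 b'b side; have lb := ltn_ord b.
have m_lt : (b - b' < n.+3)%N by lia.
apply/existsP; exists b; apply/existsP; exists (Ordinal m_lt); rewrite eqxx /=.
apply/andP; split.
  apply/eqP; congr [set _; _]; apply: val_inj.
  by apply/esym; rewrite [LHS]iter_ord_pred ?leq_subr // subKn // ltnW.
apply/forallP => l; apply/implyP => /andP[l0 lm].
rewrite nontrivialE iter_ord_pred; lia.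
Qed.

Lemma sides3 a b q c : (a < b)%N -> (b < q)%N ->
  (c \in sides [set a; b; q]) = [|| c == [set a; b], c == [set a; q] | c == [set b; q]].
Proof.
move=> ab_lt bq_lt; have aq_lt := ltn_trans ab_lt bq_lt.
have ab : a != b by rewrite -val_eqE /= neq_ltn ab_lt.
have aq : a != q by rewrite -val_eqE /= neq_ltn aq_lt.
have bq : b != q by rewrite -val_eqE /= neq_ltn bq_lt.
clear ab_lt bq_lt aq_lt; rewrite inE; apply/andP/idP => [[/cards2P[x [y [xy ->]]] /subsetP sub]|].
  have : x \in [set a; b; q] by apply: sub; rewrite set21.
  have : y \in [set a; b; q] by apply: sub; rewrite set22.
  rewrite !inE => /orP[/orP[]|]/eqP Ey /orP[/orP[]|]/eqP Ex; subst;
    rewrite ?eqxx ?orbT // in xy *; by rewrite setUC ?eqxx ?orbT // setUC.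
move=> H; have : exists x y, [/\ x != y, c = [set x; y],
    x \in [set a; b; q] & y \in [set a; b; q]].
  by case/or3P: H => /eqP ->; [exists a, b | exists a, q | exists b, q];
    split=> //; rewrite !inE eqxx ?orbT.
case=> x [y [xy -> xt yt]]; rewrite /is_curve cards2 xy; split=> //.
by apply/subsetP => z; rewrite in_set2 => /orP[]/eqP ->.
Qed.

Lemma triangle_points (t : {set pt}) : #|t| = 3 -> exists a b q,
  [/\ (a < b)%N, (b < q)%N & t = [set a; b; q]].
Proof.
move=> t3; have : sorted ltn [seq val x | x <- enum t].
  apply: (subseq_sorted ltn_trans (s2 := [seq val x | x <- enum 'I_n.+3])).
    apply: map_subseq; rewrite [X in subseq X _](_ : _ = [seq x <- enum 'I_n.+3 | x \in t]).
      exact: filter_subseq.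
    by rewrite enumT.
  by rewrite val_enum_ord iota_ltn_sorted.
have := cardE t; rewrite t3; case E: (enum t) => [|a [|b [|q []]]] //= _.
case/and3P=> ab bq _; exists a, b, q; split=> //; apply/setP => z.
by rewrite -mem_enum E !inE orbA.
Qed.

End Disk.

(** * Dissections as triangulations *)

Section Dissection.
Variables (n : nat) (Gamma : {set curve n}).
Hypothesis Gamma_diss : generalized_dissection Gamma.
Hypothesis P1_in : c_P1 n \in Gamma.
Local Notation pt := 'I_n.+3.
Implicit Types (a b q : pt) (c d : curve n).

Lemma Gamma_partial : partial_dissection Gamma.
Proof. by case/maxsetP: Gamma_diss. Qed.

Lemma Gamma_curve c : c \in Gamma -> is_curve c && ~~ boundary_segment c.
Proof. by case/andP: Gamma_partial => /forallP H _; apply/implyP. Qed.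

Lemma Gamma_nocross c d : c \in Gamma -> d \in Gamma -> ~~ cross c d.
Proof.
case/andP: Gamma_partial => _ /forallP H cG.
by have /implyP/(_ cG)/forallP/(_ d)/implyP := H c.
Qed.

Lemma c_P1E : c_P1 n = [set inord 1; ord_max].
Proof.
congr [set _; _]; apply: val_inj; last by rewrite [LHS]lift0.
by rewrite [LHS]lift0 [RHS]inordK.
Qed.

(** Every curve through p other than the two boundary segments crosses
    x_0 x_(n+1). *)
Lemma Gamma_ends c : c \in Gamma ->
  exists p : pt * pt, [/\ 0 < p.1, p.1.+1 < p.2 & c = [set p.1; p.2]]%N.
Proof.
move=> cG; have /andP[/curve_ends[a [b [ab cE]]]] := Gamma_curve cG.
have lb := ltn_ord b.
rewrite cE boundary_segmentE // negb_or => /andP[b_aS b_max].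
have a0 : (0 < a)%N.
  rewrite lt0n; apply/negP => /eqP Ea.
  have := Gamma_nocross cG P1_in; rewrite c_P1E cE /cross negb_or.
  by rewrite !interleavedE // ?inordK //=; lia.
exists (a, b); split=> //=; lia.
Qed.

Local Notation V := (vertex Gamma).

Definition to_vertex c (cG : c \in Gamma) : V :=
  exist (fun c => c \in Gamma) c cG.

Definition ends (v : V) : pt * pt := projT1 (cid (Gamma_ends (valP v))).
(** The point x_i has number i + 1. *)
Definition lft (v : V) : nat := (ends v).1.-1.
Definition rgt (v : V) : nat := (ends v).2.-1.

Lemma endsP (v : V) : exists a b, [/\ val v = [set a; b], (a = (lft v).+1 :> nat),
  (b = (rgt v).+1 :> nat) & ((lft v).+1 < rgt v)%N].
Proof.
rewrite /lft /rgt /ends; case: cid => -[a b] /= [a0 ab ->]; exists a, b; split=> //; lia.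
Qed.

Lemma endsE (v : V) a b : val v = [set a; b] -> (a < b)%N ->
  lft v = a.-1 /\ rgt v = b.-1.
Proof.
have [x [y [-> Ex Ey xy]]] := endsP v => E ab.
by have [|<- <-] := set2_lt_inj _ ab E; [lia | rewrite Ex Ey].
Qed.

Lemma Gamma_gt0 c a : c \in Gamma -> a \in c -> (0 < a)%N.
Proof.
by case/Gamma_ends=> -[x y] [/= x0 xy ->]; rewrite in_set2 => /orP[]/eqP ->; lia.
Qed.

Lemma vertexP a b : (a < b)%N -> [set a; b] \in Gamma ->
  exists v : V, [/\ val v = [set a; b], lft v = a.-1 & rgt v = b.-1].
Proof.
move=> ab abG; exists (to_vertex abG).
by have [-> ->] := @endsE (to_vertex abG) a b erefl ab.
Qed.

Lemma Gamma_segmentP a b : (0 < a)%N -> (a < b)%N ->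
  ([set a; b] \in Gamma) || boundary_segment [set a; b] = segment lft rgt a.-1 b.-1.
Proof.
move=> a0 ab; rewrite boundary_segmentE //; apply/orP/idP.
  case=> [/(vertexP ab)[v [_ <- <-]]|H]; first exact: segment_arc.
  by rewrite /segment; apply/orP; left; lia.
case/segmentP=> [E|[v Ea Eb]]; first by right; lia.
left; have [x [y [E Ex Ey _]]] := endsP v.
suff -> : [set a; b] = val v by apply: valP.
by rewrite E; congr [set _; _]; apply: val_inj => /=; lia.
Qed.

Lemma Gamma_max a b : (0 < a)%N -> (a.+1 < b)%N ->
  (forall d, d \in Gamma -> ~~ cross [set a; b] d) -> [set a; b] \in Gamma.
Proof.
move=> a0 ab nc; have lab : (a < b)%N by lia.
case/maxsetP: Gamma_diss => _ /(_ ([set a; b] |: Gamma)) <-; rewrite ?subsetU1 ?setU11 //.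
have ncC d : d \in Gamma -> ~~ cross d [set a; b].
  by move=> /nc; rewrite /cross orbC.
apply/andP; split; apply/forallP => c; apply/implyP; rewrite in_setU1.
  case/orP=> [/eqP->|/Gamma_curve //].
  rewrite /is_curve cards2 boundary_segmentE // -val_eqE /=; lia.
move=> cG; apply/forallP => d; apply/implyP; rewrite in_setU1.
case/orP: cG => [/eqP->|cG] /orP[/eqP->|dG].
- by rewrite /cross !interleavedE // ltnn.
- exact: nc.
- exact: ncC.
- exact: Gamma_nocross.
Qed.

Lemma dissection_arcs : arc_system n lft rgt.
Proof.
split.
- by move=> v; have [? [? [_ _ _]]] := endsP v.
- by move=> v; have [a [b [_ _ Eb _]]] := endsP v; have := ltn_ord b; lia.
- move=> u v El Er; apply: val_inj.
  have [a [b [-> Ea Eb _]]] := endsP u; have [a' [b' [-> Ea' Eb' _]]] := endsP v.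
  by congr [set _; _]; apply: val_inj => /=; lia.
- move=> u v uv vu; have := Gamma_nocross (valP u) (valP v); rewrite /cross negb_or.
  have [a [b [-> Ea Eb lu]]] := endsP u; have [a' [b' [-> Ea' Eb' lv]]] := endsP v.
  by rewrite !interleavedE; lia.
- have := P1_in; rewrite c_P1E => /vertexP[|v [_ El Er]]; rewrite ?inordK //.
  by exists v; rewrite ?El ?Er ?inordK.
move=> x y xy yn ncx ncy.
pose a : pt := inord x.+1; pose b : pt := inord y.+1.
have aE : a = x.+1 :> nat by rewrite /a inordK //; lia.
have bE : b = y.+1 :> nat by rewrite /b inordK //; lia.
have ab : (a < b)%N by lia.
have nc (v : V) : ~~ cross [set a; b] (val v).
  have [a' [b' [-> Ea' Eb' lv]]] := endsP v; have := ncx v; have := ncy v.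
  by rewrite /cross !interleavedE; lia.
have abG : [set a; b] \in Gamma.
  by apply: Gamma_max => [||d dG]; [lia | lia | exact: (nc (to_vertex dG))].
have [v [_ El Er]] := vertexP ab abG.
by exists v; lia.
Qed.

Lemma Tri_intro a b q : (a < b)%N -> (b < q)%N ->
  ([set a; b] \in Gamma) || boundary_segment [set a; b] ->
  ([set a; q] \in Gamma) || boundary_segment [set a; q] ->
  ([set b; q] \in Gamma) || boundary_segment [set b; q] ->
  [set a; b; q] \in Tri Gamma.
Proof.
move=> ab bq Hab Haq Hbq; have aq := ltn_trans ab bq; rewrite inE; apply/andP; split.
  rewrite setUC cardsU1 cards2 in_set2 negb_or -!val_eqE /= ![val q == _]eq_sym.
  by rewrite !neq_ltn ab bq aq.
apply/forallP => c; apply/implyP; rewrite sides3 //.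
by case/or3P=> /eqP ->.
Qed.

Lemma Tri_side (t : {set pt}) c : t \in Tri Gamma -> c \in sides t ->
  (c \in Gamma) || boundary_segment c.
Proof. by rewrite inE => /andP[_ /forallP/(_ c)/implyP]. Qed.

(** Moving the end b of q b clockwise to b' keeps both on the same side of q: if
    q is before b' the common end is the left one, otherwise the right one; the
    third side b' b of the triangle is the segment in the definition of the
    arrow. *)
Lemma arrow_arcs (u v : V) :
  arrow Gamma (val u) (val v) = left_arrow lft rgt u v || right_arrow lft rgt u v.
Proof.
apply/idP/idP.
  case/andP=> neq /existsP[t /andP[tT /and3P[ut vt /existsP[q /andP[]]]]].
  rewrite in_setI => /andP[_ qv] cw.
  have [b [Evb qb]] : exists b, val v = [set q; b] /\ q != b.
    have /andP[+ _] := Gamma_curve (valP v).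
    rewrite /is_curve => /cards2P[x [y [xy Ev]]]; move: qv; rewrite Ev in_set2.
    case/orP=> /eqP ->; first by exists y.
    by exists x; rewrite setUC eq_sym.
  have q0 := Gamma_gt0 (valP v) qv.
  have b0 : (0 < b)%N by apply: Gamma_gt0 (valP v) _; rewrite Evb set22.
  rewrite Evb in cw neq.
  have [b' Eub /andP[/andP[b'0 b'b] side]] := clockwise_move_ends q0 b0 qb cw neq.
  have : [set b'; b] \in sides t.
    rewrite inE /is_curve cards2 -val_eqE neq_ltn /= b'b /=.
    move: ut vt; rewrite !inE Eub Evb => /andP[_ /subsetP H1] /andP[_ /subsetP H2].
    by apply/subsetP => z; rewrite in_set2 => /orP[]/eqP ->;
      [apply: H1; rewrite set22 | apply: H2; rewrite set22].
  move=> /(Tri_side tT); rewrite Gamma_segmentP // /left_arrow /right_arrow => seg.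
  have lt : (b'.-1 < b.-1)%N by clear - b'0 b'b; lia.
  case/orP: side => side.
    have [-> ->] := endsE Eub side; have [-> ->] := endsE Evb (ltn_trans side b'b).
    by rewrite eqxx lt seg.
  rewrite setUC in Eub; rewrite setUC in Evb.
  have [-> ->] := endsE Evb side; have [-> ->] := endsE Eub (ltn_trans b'b side).
  by rewrite eqxx lt seg orbT.
have [au [bu [Eu Eau Ebu lu]]] := endsP u; have [av [bv [Ev Eav Ebv lv]]] := endsP v.
have uG := valP u; have vG := valP v.
case/orP=> /and3P[/eqP E lt seg].
  have Ea : au = av by apply: val_inj => /=; lia.
  subst au; have b_lt : (bu < bv)%N by lia.
  have ab : (av < bu)%N by lia.
  rewrite Eu Ev in uG vG *; apply/andP; split.
    have ab' := ltn_trans ab b_lt; apply: contraTneq b_lt => E'.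
    by have [_ ->] := set2_lt_inj ab ab' E'; rewrite ltnn.
  apply/existsP; exists [set av; bu; bv]; apply/andP; split.
    apply: Tri_intro; rewrite ?uG ?vG // Gamma_segmentP ?Ebu ?Ebv //.
  rewrite !sides3 // !eqxx !orbT /=; apply/existsP; exists av.
  rewrite in_setI !set21 /=.
  by apply: clockwise_move_intro; lia.
have Eb : bu = bv by apply: val_inj => /=; lia.
subst bu; have a_lt : (au < av)%N by lia.
have ab : (av < bv)%N by lia.
rewrite Eu Ev in uG vG *; apply/andP; split.
  have ab' := ltn_trans a_lt ab; apply: contraTneq a_lt => E'.
  by have [-> _] := set2_lt_inj ab' ab E'; rewrite ltnn.
apply/existsP; exists [set au; av; bv]; apply/andP; split.
  by apply: Tri_intro; rewrite ?uG ?vG // Gamma_segmentP ?Eau ?Eav //.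
rewrite !sides3 // !eqxx !orbT /=; apply/existsP; exists bv.
rewrite in_setI !set22 /= ![[set _; bv]]setUC.
by apply: clockwise_move_intro; lia.
Qed.

Lemma same_triangle_intro (u v w : V) :
  lft u = lft v -> rgt u = lft w -> rgt v = rgt w ->
  same_triangle Gamma (val u) (val v) (val w).
Proof.
have [au [bu [Eu Eau Ebu lu]]] := endsP u; have [av [bv [Ev Eav Ebv lv]]] := endsP v.
have [aw [bw [Ew Eaw Ebw lw]]] := endsP w => E1 E2 E3.
have Ea : av = au by apply: val_inj => /=; lia.
have Eb : aw = bu by apply: val_inj => /=; lia.
have Ec : bw = bv by apply: val_inj => /=; lia.
subst aw bw av; apply/existsP; exists [set au; bu; bv].
have := valP u; have := valP v; have := valP w; rewrite Eu Ev Ew => wG vG uG.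
have ab : (au < bu)%N by lia.
have bq : (bu < bv)%N by lia.
apply/andP; split; first by apply: Tri_intro; rewrite ?uG ?vG ?wG.
by apply/eqP/setP => c; rewrite sides3 // !inE orbA.
Qed.

(** Two arrows moving the same end point involve three other end points, so the
    three curves have four ends in total and no common triangle. *)
Lemma same_triangle_arc_rel (u v w : V) :
  same_triangle Gamma (val u) (val v) (val w) ->
  arrow Gamma (val u) (val v) -> arrow Gamma (val v) (val w) ->
  ~~ arc_rel lft rgt u w.
Proof.
case/existsP=> t /andP[]; rewrite inE => /andP[/eqP t3 _] /eqP st.
have sub (x : V) : val x \in [set val u; val v; val w] -> val x \subset t.
  by rewrite -st inE => /andP[].
have {}sub z : z \in val u :|: val v :|: val w -> z \in t.
  rewrite !in_setU => /orP[/orP[]|]; apply: subsetP z; apply: sub; rewrite !inE eqxx ?orbT //.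
have [au [bu [Eu Eau Ebu lu]]] := endsP u; have [av [bv [Ev Eav Ebv lv]]] := endsP v.
have [aw [bw [Ew Eaw Ebw lw]]] := endsP w.
have four (s : seq pt) : uniq s -> {subset s <= val u :|: val v :|: val w} -> (size s <= 3)%N.
  move=> us ss; have := uniq_leq_size us (s2 := enum t); rewrite -cardE t3; apply.
  by move=> z /ss/sub; rewrite mem_enum.
rewrite !arrow_arcs => uv vw; case/orP: uv vw => uv /orP[] vw.
- case/and3P: uv => /eqP ? ? _; case/and3P: vw => /eqP ? ? _.
  have := four [:: au; bu; bv; bw]; rewrite /= !inE -!val_eqE /=.
  move=> H; suff : false by []; apply: H; first by rewrite /=; lia.
  by move=> z; rewrite Eu Ev Ew !inE => /or4P[]/eqP ->; rewrite eqxx ?orbT.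
- case/and3P: uv => /eqP ? ? _; case/and3P: vw => /eqP ? ? _; rewrite /arc_rel; lia.
- by have := right_left_arrow dissection_arcs uv vw.
- case/and3P: uv => /eqP ? ? _; case/and3P: vw => /eqP ? ? _.
  have := four [:: au; av; aw; bw]; rewrite /= !inE -!val_eqE /=.
  move=> H; suff : false by []; apply: H; first by rewrite /=; lia.
  by move=> z; rewrite Eu Ev Ew !inE => /or4P[]/eqP ->; rewrite eqxx ?orbT.
Qed.

(** A complete triangle avoids p, as its sides are curves of the dissection. *)
Lemma complete_triangleP :
  (exists2 t, t \in Tri Gamma & complete Gamma t) <->
  (exists u v w, [/\ lft u = lft v, rgt u = lft w & rgt v = rgt w]).
Proof.
split.
  case=> t tT /subsetP tG.
  have /triangle_points[a [b [q [ab bq tE]]]] : #|t| = 3.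
    by move: tT; rewrite inE => /andP[/eqP].
  have sE c : (c \in sides t) = [|| c == [set a; b], c == [set a; q] | c == [set b; q]].
    by rewrite tE sides3.
  have abG : [set a; b] \in Gamma by apply: tG; rewrite sE eqxx.
  have aqG : [set a; q] \in Gamma by apply: tG; rewrite sE eqxx orbT.
  have bqG : [set b; q] \in Gamma by apply: tG; rewrite sE eqxx !orbT.
  have a0 : (0 < a)%N by apply: Gamma_gt0 abG _; rewrite set21.
  have [u [_ Eu1 Eu2]] := vertexP ab abG; have [w [_ Ew1 Ew2]] := vertexP bq bqG.
  have [v [_ Ev1 Ev2]] := vertexP (ltn_trans ab bq) aqG.
  by exists u, v, w; rewrite Eu1 Eu2 Ev1 Ev2 Ew1 Ew2.
case=> u [v [w [E1 E2 E3]]]; have /existsP[t /andP[tT /eqP st]] := same_triangle_intro E1 E2 E3.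
exists t => //; rewrite /complete st; apply/subsetP => c.
by rewrite !inE => /orP[/orP[]|]/eqP ->; apply: valP.
Qed.

Lemma A_Gamma_coordinates (k : comNzRingType) :
  inhabited (coordinates (A_Gamma k P1_in) (arc_rel lft rgt)).
Proof.
apply: (arc_coordinates dissection_arcs).
- exact: arrow_arcs.
- exact: same_triangle_intro.
- exact: same_triangle_arc_rel.
Qed.

End Dissection.

Theorem theorem1p3 (k : closedFieldType) (n : nat) (n_gt0 : (0 < n)%N)
    (Gamma : {set curve n}) (Gamma_diss : generalized_dissection Gamma)
    (P1_in : c_P1 n \in Gamma) :
  ((~ exists2 t, t \in Tri Gamma & complete Gamma t) ->
     hereditary (A_Gamma k P1_in) /\
     tilted_of (linear_alg k n_gt0) (A_Gamma k P1_in)) /\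
  ((exists2 t, t \in Tri Gamma & complete Gamma t) ->
     ~ hereditary (A_Gamma k P1_in) /\
     tilted_of (linear_alg k n_gt0) (A_Gamma k P1_in)).
Proof.
have arcs := dissection_arcs Gamma_diss P1_in.
have [cA] := linear_coordinates k n_gt0.
have [cB] := A_Gamma_coordinates Gamma_diss P1_in k.
have tilted := arc_tilted arcs cA cB.
have triP := complete_triangleP Gamma_diss P1_in.
split=> H; split=> //.
- by apply: (arc_hereditary arcs cB) => /triP.
- by apply: (arc_not_hereditary arcs cB); apply/triP.
Qed.
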